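(* Let $k$ be a real number with $0<k^2<1$. If the series below converges, then $$\sum_{n=0}^{\infty} \frac{(-1)^{\lfloor n/2\rfloor}}{e^{(2n+1)\frac{K'}{K}\pi}-1} = \frac{\left(\sqrt{1-k}+\sqrt{1+k}\right)K}{2\pi}-\frac12.$$
   Context: For the elliptic modulus $k$ (with $0<k^2<1$), write $k'=\sqrt{1-k^2}$. The complete elliptic integral of the first kind is $K=K(k)=\int_0^{\pi/2}\frac{d\theta}{\sqrt{1-k^2\sin^2\theta}}$, and $K'=K(k')$. *)

(* Defs.v *)
From Stdlib Require Import Reals.
From Coquelicot Require Import Coquelicot.
Open Scope R_scope.

Definition compl_modulus (k : R) : R := sqrt (1 - k ^ 2).

(* The argument is the modulus k, not the parameter m = k ^ 2. *)
Definition ellipticK (k : R) : R :=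
  RInt (fun theta : R => 1 / sqrt (1 - k ^ 2 * sin theta ^ 2)) 0 (PI / 2).

Definition ellipticK' (k : R) : R := ellipticK (compl_modulus k).

(* On nat, (n / 2) is the integral part of n/2. *)
Definition lambert_term (k : R) (n : nat) : R :=
  (-1) ^ (n / 2)%nat
  / (exp ((2 * INR n + 1) * (ellipticK' k / ellipticK k) * PI) - 1).

(* Main.v *)
Require Import Defs.
From Stdlib Require Import Reals Ranalysis5 Lra Lia ZArith.
From Coquelicot Require Import Coquelicot.
Open Scope R_scope.

(** Write [q = exp (- PI K' / K)]. The left-hand side is
    [sum_m chi(m) q^m / (1 - q^m)], where [chi] is the quadratic character modulo 8
    attached to the form [x^2 + 2 y^2]; it equals
    [(theta q * theta (q^2) - 1) / 2] with [theta q = sum_(n in Z) q^(n^2)]. The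
    right-hand side is the same quantity, because [theta q ^ 2 = 2 K / PI] and,
    since [theta (- q) ^ 2 = k' theta q ^ 2],
    [theta (q^2) ^ 2 = (1 + k') theta q ^ 2 / 2], whereas
    [(sqrt (1 - k) + sqrt (1 + k)) ^ 2 = 2 (1 + k')].

    Everything rests on iterating [q |-> q^2], which drives [q] to 0 where all
    quantities are explicit.

    The arithmetic half is [lambert_sum_eq_theta]. Summing over [m] turns
    [1 + 2 sum_m chi(m) q^m / (1 - q^m)] into twice
    [L q = sum_(j in Z) q^j / (1 + q^(4 j))]. The product [L q * theta (- q)] is an
    even function of [q] ([lambert_sum_mul_theta_opp]), and this alone forces
    [L q / (theta q * theta (q^2))] to be invariant under [q |-> q^2], hence constant.

    The analytic half, [elliptic_nome], goes through the arithmetic-geometric mean.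
    The pair [(theta q ^ 2, theta (- q) ^ 2)] performs an AGM step when [q] is
    squared ([theta_mul_theta_opp], [theta_sqr_add_theta_opp_sqr]), and Gauss's
    integral is invariant under such a step ([gauss_int_landen]), so its value is
    [PI / 2] ([gauss_int_theta]). The complementary integral doubles
    instead ([gauss_int_theta2_step]); comparing with its logarithmic singularity
    identifies it as [- ln q / 2] ([gauss_int_theta2]). Every complementary modulus in
    (0, 1) arises from some [q] in this way ([nome_exists]). *)

(** * Real series *)

Lemma sum_n_S (a : nat -> R) (N : nat) : sum_n a (S N) = sum_n a N + a (S N) :> R.
Proof. exact (sum_Sn a N). Qed.

Lemma sum_n_0 (a : nat -> R) : sum_n a 0 = a 0%nat :> R.
Proof. exact (sum_O a). Qed.

Lemma ex_series_dominated (a b : nat -> R) :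
  (forall n, Rabs (a n) <= b n) -> ex_series b -> ex_series a.
Proof. exact (ex_series_le a b). Qed.

Lemma sum_n_nonneg (a : nat -> R) (N : nat) :
  (forall n, 0 <= a n) -> 0 <= sum_n a N.
Proof.
  intros Ha. induction N as [|N IH]; rewrite ?sum_n_0, ?sum_n_S; [apply Ha|].
  apply Rplus_le_le_0_compat; [exact IH | apply Ha].
Qed.

Lemma Series_ge_sum (a : nat -> R) (N : nat) :
  (forall n, 0 <= a n) -> ex_series a -> sum_n a N <= Series a.
Proof.
  intros Ha Ea.
  apply (is_lim_seq_incr_compare (sum_n a) (Series a)).
  - apply Series_correct, Ea.
  - intros n. rewrite sum_n_S. specialize (Ha (S n)). lra.
Qed.

Lemma ex_series_bounded (a : nat -> R) (B : R) :
  (forall n, 0 <= a n) -> (forall N, sum_n a N <= B) -> ex_series a.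
Proof.
  intros Ha HB.
  destruct (ex_finite_lim_seq_incr (sum_n a) B) as [l Hl].
  - intros n. rewrite sum_n_S. specialize (Ha (S n)). lra.
  - exact HB.
  - exists l. exact Hl.
Qed.

Lemma Series_split_parity (a : nat -> R) :
  ex_series (fun n => Rabs (a n)) ->
  ex_series (fun n => a (2 * n)%nat) /\ ex_series (fun n => a (2 * n + 1)%nat) /\
  Series a = Series (fun n => a (2 * n)%nat) + Series (fun n => a (2 * n + 1)%nat).
Proof.
  intros Ha.
  assert (Hsum : forall (u : nat -> R) N,
    sum_n u (2 * N + 1)%nat =
    sum_n (fun n => u (2 * n)%nat) N + sum_n (fun n => u (2 * n + 1)%nat) N :> R).
  { intros u N. induction N as [|N IH].
    - simpl. rewrite sum_n_S, !sum_n_0. reflexivity.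
    - replace (2 * S N + 1)%nat with (S (S (2 * N + 1))) by lia.
      rewrite !sum_n_S, IH.
      replace (S (2 * N + 1)) with (2 * S N)%nat by lia.
      replace (S (2 * S N)) with (2 * S N + 1)%nat by lia.
      ring. }
  assert (Hpos : forall (s : nat), (s < 2)%nat ->
    ex_series (fun n => Rabs (a (2 * n + s)%nat))).
  { intros s Hs. apply ex_series_bounded with (Series (fun n => Rabs (a n))).
    - intros n; apply Rabs_pos.
    - intros N. apply Rle_trans with (sum_n (fun n => Rabs (a n)) (2 * N + 1)).
      + rewrite (Hsum (fun n => Rabs (a n))).
        assert (H0 : forall s', 0 <= sum_n (fun n => Rabs (a (2 * n + s')%nat)) N)
          by (intros s'; apply sum_n_nonneg; intros n; apply Rabs_pos).
        destruct s as [|[|s]]; [ | | lia].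
        * specialize (H0 1%nat).
          rewrite (sum_n_ext (fun n => Rabs (a (2 * n + 0)%nat)) (fun n => Rabs (a (2 * n)%nat))).
          lra. intros n; f_equal; f_equal; lia.
        * specialize (H0 0%nat).
          rewrite (sum_n_ext (fun n => Rabs (a (2 * n + 0)%nat)) (fun n => Rabs (a (2 * n)%nat))) in H0.
          lra. intros n; f_equal; f_equal; lia.
      + apply Series_ge_sum; [intros; apply Rabs_pos | exact Ha]. }
  assert (E0 : ex_series (fun n => a (2 * n)%nat)).
  { apply ex_series_ext with (fun n => a (2 * n + 0)%nat). intros n; f_equal; lia.
    apply ex_series_Rabs, Hpos; lia. }
  assert (E1 : ex_series (fun n => a (2 * n + 1)%nat)).
  { apply ex_series_Rabs, (Hpos 1%nat); lia. }
  split; [exact E0|split; [exact E1|]].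
  assert (L1 : is_lim_seq (fun N => sum_n a (2 * N + 1)%nat) (Series a)).
  { apply (is_lim_seq_subseq (sum_n a) (Series a) (fun N => (2 * N + 1)%nat)).
    - apply eventually_subseq. intros n; lia.
    - apply Series_correct, ex_series_Rabs, Ha. }
  assert (L2 : is_lim_seq (fun N => sum_n a (2 * N + 1)%nat)
     (Series (fun n => a (2 * n)%nat) + Series (fun n => a (2 * n + 1)%nat))).
  { apply is_lim_seq_ext with
     (fun N => sum_n (fun n => a (2 * n)%nat) N + sum_n (fun n => a (2 * n + 1)%nat) N).
    - intros N; symmetry; apply Hsum.
    - apply is_lim_seq_plus'; apply Series_correct; assumption. }
  apply is_lim_seq_unique in L1. apply is_lim_seq_unique in L2.
  rewrite L1 in L2. now injection L2.
Qed.

(** Dominated convergence for series along an arbitrary filter. Used along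
    [eventually] to exchange two infinite sums, along [at_right 0] for limits
    at [q = 0], and along [locally x] for continuity. *)
Lemma Series_tannery {T : Type} (F : (T -> Prop) -> Prop) {FF : Filter F}
  (a : T -> nat -> R) (l b : nat -> R) :
  ex_series b ->
  F (fun t => forall n, Rabs (a t n) <= b n) ->
  (forall n, Rabs (l n) <= b n) ->
  (forall n, filterlim (fun t => a t n) F (locally (l n))) ->
  filterlim (fun t => Series (a t)) F (locally (Series l)).
Proof.
  intros Eb Hab Hlb Hlim.
  apply filterlim_locally. intros eps.
  assert (Hb0 : forall n, 0 <= b n).
  { intros n. apply Rle_trans with (Rabs (l n)); [apply Rabs_pos | apply Hlb]. }
  assert (E4 : 0 < eps / 4) by (destruct eps; simpl; lra).
  destruct Eb as [B HB].
  assert (Eb : ex_series b) by (exists B; exact HB).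
  destruct (proj1 (filterlim_locally _ _) HB (mkposreal _ E4)) as [N HN].
  specialize (HN N (le_n _)).
  assert (Htail : Series (fun n => b (S N + n)%nat) < eps / 4).
  { assert (HS := Series_incr_n b (S N) ltac:(lia) Eb).
    simpl pred in HS.
    rewrite (is_series_unique _ _ HB) in HS.
    unfold ball in HN; simpl in HN; unfold AbsRing_ball in HN; simpl in HN.
    unfold abs, minus, plus, opp in HN; simpl in HN.
    rewrite sum_n_Reals in HN.
    apply Rabs_def2 in HN. lra. }
  assert (Hfin : F (fun t => Rabs (sum_n (a t) N - sum_n l N) < eps / 4)).
  { assert (HH : filterlim (fun t => sum_n (a t) N) F (locally (sum_n l N))).
    { clear - Hlim FF. induction N as [|N IH].
      - rewrite sum_n_0. apply filterlim_ext with (fun t => a t 0%nat).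
        intros t; now rewrite sum_n_0. apply Hlim.
      - rewrite sum_n_S. apply filterlim_ext with (fun t => sum_n (a t) N + a t (S N)).
        intros t; now rewrite sum_n_S.
        eapply filterlim_comp_2; [exact IH | apply Hlim |].
        apply (filterlim_plus (V := R_NormedModule)). }
    apply filterlim_locally with (1 := HH) (eps := mkposreal _ E4). }
  generalize (filter_and _ _ Hab Hfin). apply filter_imp. intros t [Ht1 Ht2].
  assert (key : forall u : nat -> R, (forall n, Rabs (u n) <= b n) ->
     Rabs (Series u - sum_n u N) < eps / 4).
  { intros u Hu.
    assert (Eu : ex_series u).
    { apply (ex_series_dominated u b); [exact Hu | exact Eb]. }
    rewrite (Series_incr_n u (S N) ltac:(lia) Eu). simpl pred.
    rewrite <- sum_n_Reals.
    replace (sum_n u N + Series (fun k => u (S N + k)%nat) - sum_n u N)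
      with (Series (fun k => u (S N + k)%nat)) by ring.
    assert (Eb' : ex_series (fun k => b (S N + k)%nat)) by (now apply (ex_series_incr_n b (S N))).
    eapply Rle_lt_trans; [|exact Htail].
    eapply Rle_trans.
    - apply Series_Rabs. apply ex_series_dominated with (2 := Eb').
      intros n. rewrite Rabs_Rabsolu. apply Hu.
    - apply Series_le; [|exact Eb'].
      intros n. split; [apply Rabs_pos | apply Hu]. }
  unfold ball; simpl; unfold AbsRing_ball; simpl; unfold abs, minus, plus, opp; simpl.
  assert (K1 := key _ Ht1). assert (K2 := key _ Hlb).
  destruct eps as [e he]; simpl in *.
  apply Rabs_def2 in K1. apply Rabs_def2 in K2. apply Rabs_def2 in Ht2.
  apply Rabs_def1; lra.
Qed.

(** * Absolutely convergent sums over the integers *)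

(** Pairing [n] with [-1 - n] enumerates [Z] by a single ordinary series whose
    partial sums run over the blocks [-N <= k <= N - 1]. *)
Definition zpair (f : Z -> R) (n : nat) : R :=
  f (Z.of_nat n) + f (-1 - Z.of_nat n)%Z.

Definition zsummable (f : Z -> R) : Prop := ex_series (zpair (fun n => Rabs (f n))).

Definition zsum (f : Z -> R) : R := Series (zpair f).

Lemma zpair_Rabs f n : Rabs (zpair f n) <= zpair (fun m => Rabs (f m)) n.
Proof. apply Rabs_triang. Qed.

Lemma zsummable_le f g :
  (forall n, Rabs (f n) <= g n) -> zsummable g -> zsummable f.
Proof.
  intros H Hg. unfold zsummable. eapply ex_series_dominated; [|exact Hg].
  intros n. unfold zpair. rewrite Rabs_pos_eq.
  - apply Rplus_le_compat; (eapply Rle_trans; [apply H | apply Rle_abs]).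
  - apply Rplus_le_le_0_compat; apply Rabs_pos.
Qed.

Lemma zsum_halves f : zsummable f ->
  ex_series (fun n => Rabs (f (Z.of_nat n))) /\
  ex_series (fun n => Rabs (f (-1 - Z.of_nat n)%Z)).
Proof.
  intros H; split; eapply ex_series_dominated; [ |exact H| |exact H];
  intros n; rewrite Rabs_Rabsolu; unfold zpair;
  [pose proof (Rabs_pos (f (-1 - Z.of_nat n)%Z)) | pose proof (Rabs_pos (f (Z.of_nat n)))]; lra.
Qed.

Lemma zsum_halves_eq f : zsummable f ->
  zsum f = Series (fun n => f (Z.of_nat n)) + Series (fun n => f (-1 - Z.of_nat n)%Z).
Proof.
  intros H. destruct (zsum_halves f H) as [H1 H2].
  unfold zsum, zpair. apply Series_plus; apply ex_series_Rabs; assumption.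
Qed.

Lemma zsummable_of_halves f :
  ex_series (fun n => Rabs (f (Z.of_nat n))) ->
  ex_series (fun n => Rabs (f (-1 - Z.of_nat n)%Z)) -> zsummable f.
Proof. intros H1 H2. apply (ex_series_plus _ _ H1 H2). Qed.

Lemma zsummable_ex f : zsummable f -> ex_series (zpair f).
Proof.
  intros H. eapply ex_series_dominated; [|exact H]. intros n. apply zpair_Rabs.
Qed.

Lemma zsum_ext f g : (forall n, f n = g n) -> zsum f = zsum g.
Proof. intros H. apply Series_ext; intros n; unfold zpair; now rewrite !H. Qed.

Lemma zsummable_ext f g : (forall n, f n = g n) -> zsummable f -> zsummable g.
Proof. intros H. apply ex_series_ext; intros n; unfold zpair; now rewrite !H. Qed.

Lemma zsummable_abs f : zsummable f -> zsummable (fun n => Rabs (f n)).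
Proof.
  apply ex_series_ext; intros n; unfold zpair; now rewrite !Rabs_Rabsolu.
Qed.

Lemma zsummable_scal c f : zsummable f -> zsummable (fun n => c * f n).
Proof.
  intros H. apply ex_series_dominated with (fun n => Rabs c * zpair (fun m => Rabs (f m)) n).
  - intros n. unfold zpair. rewrite !Rabs_mult, <- Rmult_plus_distr_l, Rabs_mult, Rabs_Rabsolu.
    apply Rmult_le_compat_l; [apply Rabs_pos|]. rewrite Rabs_pos_eq; [apply Rle_refl|].
    apply Rplus_le_le_0_compat; apply Rabs_pos.
  - exact (ex_series_scal_l (Rabs c) _ H).
Qed.

Lemma zsum_scal c f : zsum (fun n => c * f n) = c * zsum f.
Proof.
  unfold zsum. rewrite <- Series_scal_l. apply Series_ext; intros n; unfold zpair; ring.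
Qed.

Lemma zsum_plus f g : zsummable f -> zsummable g ->
  zsum (fun n => f n + g n) = zsum f + zsum g.
Proof.
  intros Hf Hg. unfold zsum. rewrite <- Series_plus; try now apply zsummable_ex.
  apply Series_ext; intros n; unfold zpair; ring.
Qed.

Lemma zsummable_plus f g : zsummable f -> zsummable g -> zsummable (fun n => f n + g n).
Proof.
  intros Hf Hg. apply zsummable_le with (fun n => Rabs (f n) + Rabs (g n)).
  - intros n; apply Rabs_triang.
  - unfold zsummable. eapply ex_series_ext; [|apply (ex_series_plus _ _ Hf Hg)].
    intros n. unfold zpair, plus; simpl.
    rewrite !(Rabs_pos_eq (_ + _)); try (apply Rplus_le_le_0_compat; apply Rabs_pos). ring.
Qed.

Lemma zsum_le f g : (forall n, 0 <= f n <= g n) -> zsummable g -> zsum f <= zsum g.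
Proof.
  intros H Hg. apply Series_le.
  - intros n. unfold zpair. pose proof (H (Z.of_nat n)). pose proof (H (-1 - Z.of_nat n)%Z). lra.
  - now apply zsummable_ex.
Qed.

Lemma zsum_opp_arg f : zsummable f ->
  zsummable (fun n => f (- n)%Z) /\ zsum (fun n => f (- n)%Z) = zsum f.
Proof.
  intros H. destruct (zsum_halves f H) as [H1 H2].
  assert (E : zsummable (fun n => f (- n)%Z)).
  { apply zsummable_of_halves.
    - apply ex_series_incr_1. eapply ex_series_ext; [|exact H2].
      intros n; cbv beta; do 2 f_equal; lia.
    - apply ex_series_incr_1 in H1. eapply ex_series_ext; [|exact H1].
      intros n; cbv beta; do 2 f_equal; lia. }
  split; [exact E|].
  rewrite !zsum_halves_eq by assumption.
  rewrite (Series_incr_1 (fun n => f (Z.of_nat n))) by now apply ex_series_Rabs.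
  rewrite (Series_incr_1 (fun n => f (- Z.of_nat n)%Z)).
  2:{ destruct (zsum_halves _ E) as [E1 _]. now apply ex_series_Rabs in E1. }
  rewrite (Series_ext (fun k => f (- Z.of_nat (S k))%Z) (fun n => f (-1 - Z.of_nat n)%Z))
    by (intros n; f_equal; lia).
  rewrite (Series_ext (fun n => f (- (-1 - Z.of_nat n))%Z) (fun k => f (Z.of_nat (S k))))
    by (intros n; f_equal; lia).
  simpl. ring.
Qed.

(** The involution [n |-> -1 - n] merely swaps the two entries of each pair;
    composed with [n |-> - n] it gives the unit shifts. *)
Lemma zsum_flip f : zsum (fun n => f (-1 - n)%Z) = zsum f.
Proof.
  apply Series_ext. intros n. unfold zpair.
  replace (-1 - (-1 - Z.of_nat n))%Z with (Z.of_nat n) by lia. ring.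
Qed.

Lemma zsummable_flip f : zsummable f -> zsummable (fun n => f (-1 - n)%Z).
Proof.
  apply ex_series_ext. intros n. unfold zpair.
  replace (-1 - (-1 - Z.of_nat n))%Z with (Z.of_nat n) by lia. apply Rplus_comm.
Qed.

Lemma zsum_shift f k : zsummable f ->
  zsummable (fun n => f (n + k)%Z) /\ zsum (fun n => f (n + k)%Z) = zsum f.
Proof.
  assert (S1 : forall f, zsummable f ->
    zsummable (fun n => f (n + 1)%Z) /\ zsum (fun n => f (n + 1)%Z) = zsum f).
  { clear. intros f H.
    destruct (zsum_opp_arg f H) as [Ho Eo].
    split.
    - apply zsummable_flip in Ho. eapply zsummable_ext; [|exact Ho]. intros n; cbv beta; f_equal; lia.
    - rewrite <- Eo, <- (zsum_flip (fun n => f (- n)%Z)). apply zsum_ext.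
      intros n; f_equal; lia. }
  assert (S2 : forall f, zsummable f ->
    zsummable (fun n => f (n - 1)%Z) /\ zsum (fun n => f (n - 1)%Z) = zsum f).
  { clear. intros f H.
    pose proof (zsummable_flip _ H) as Hf.
    destruct (zsum_opp_arg _ Hf) as [Ho Eo].
    split.
    - eapply zsummable_ext; [|exact Ho]. intros n; cbv beta; f_equal; lia.
    - rewrite <- (zsum_flip f), <- Eo. apply zsum_ext.
      intros n; f_equal; lia. }
  intros H. revert k.
  apply Z.bi_induction.
  - intros x y ->. tauto.
  - split; [eapply zsummable_ext; [|exact H] | apply zsum_ext];
    intros n; now rewrite Z.add_0_r.
  - intros k; split; intros [Hk Ek].
    + destruct (S1 _ Hk) as [A B]. split.
      * eapply zsummable_ext; [|exact A]. intros n; cbv beta; f_equal; lia.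
      * rewrite <- Ek, <- B. apply zsum_ext; intros n; f_equal; lia.
    + destruct (S2 _ Hk) as [A B]. split.
      * eapply zsummable_ext; [|exact A]. intros n; cbv beta; f_equal; lia.
      * rewrite <- Ek, <- B. apply zsum_ext; intros n; f_equal; lia.
Qed.

Lemma zsum_reflect f k : zsummable f -> zsum (fun n => f (k - n)%Z) = zsum f.
Proof.
  intros H. destruct (zsum_shift f k H) as [S1 S2].
  rewrite <- S2, <- (proj2 (zsum_opp_arg _ S1)). apply zsum_ext; intros n; f_equal; lia.
Qed.

Lemma zsum_split_parity f : zsummable f ->
  zsummable (fun n => f (2 * n)%Z) /\ zsummable (fun n => f (2 * n + 1)%Z) /\
  zsum f = zsum (fun n => f (2 * n)%Z) + zsum (fun n => f (2 * n + 1)%Z).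
Proof.
  intros H. destruct (zsum_halves f H) as [H1 H2].
  assert (P1 := Series_split_parity _ H1).
  assert (P2 := Series_split_parity _ H2).
  assert (A : forall u : nat -> R, ex_series (fun n => Rabs (u n)) -> ex_series (fun n => Rabs (Rabs (u n)))).
  { intros u. apply ex_series_ext. intros n; now rewrite Rabs_Rabsolu. }
  assert (Q1 := Series_split_parity (fun n => Rabs (f (Z.of_nat n))) (A _ H1)).
  assert (Q2 := Series_split_parity (fun n => Rabs (f (-1 - Z.of_nat n)%Z)) (A _ H2)).
  destruct Q1 as (Q1a & Q1b & _), Q2 as (Q2a & Q2b & _).
  assert (E0 : zsummable (fun n => f (2 * n)%Z)).
  { apply zsummable_of_halves.
    - eapply ex_series_ext; [|exact Q1a]. intros n; cbv beta; do 2 f_equal; lia.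
    - eapply ex_series_ext; [|exact Q2b]. intros n; cbv beta; do 2 f_equal; lia. }
  assert (E1 : zsummable (fun n => f (2 * n + 1)%Z)).
  { apply zsummable_of_halves.
    - eapply ex_series_ext; [|exact Q1b]. intros n; cbv beta; do 2 f_equal; lia.
    - eapply ex_series_ext; [|exact Q2a]. intros n; cbv beta; do 2 f_equal; lia. }
  split; [exact E0|split; [exact E1|]].
  rewrite !zsum_halves_eq by assumption.
  destruct P1 as (_ & _ & ->), P2 as (_ & _ & ->).
  rewrite (Series_ext (fun n => f (Z.of_nat (2 * n))) (fun n => f (2 * Z.of_nat n)%Z))
    by (intros n; f_equal; lia).
  rewrite (Series_ext (fun n => f (Z.of_nat (2 * n + 1))) (fun n => f (2 * Z.of_nat n + 1)%Z))
    by (intros n; f_equal; lia).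
  rewrite (Series_ext (fun n => f (-1 - Z.of_nat (2 * n))%Z) (fun n => f (2 * (-1 - Z.of_nat n) + 1)%Z))
    by (intros n; f_equal; lia).
  rewrite (Series_ext (fun n => f (-1 - Z.of_nat (2 * n + 1))%Z) (fun n => f (2 * (-1 - Z.of_nat n))%Z))
    by (intros n; f_equal; lia).
  ring.
Qed.

Lemma zsum_tannery {T : Type} (F : (T -> Prop) -> Prop) {FF : Filter F}
  (a : T -> Z -> R) (l b : Z -> R) :
  zsummable b ->
  F (fun t => forall n, Rabs (a t n) <= b n) ->
  (forall n, Rabs (l n) <= b n) ->
  (forall n, filterlim (fun t => a t n) F (locally (l n))) ->
  filterlim (fun t => zsum (a t)) F (locally (zsum l)).
Proof.
  intros Hb Hab Hlb Hlim. unfold zsum.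
  apply (Series_tannery F (fun t => zpair (a t)) (zpair l) (zpair b)).
  - now apply zsummable_ex.
  - revert Hab; apply filter_imp. intros t Ht n. eapply Rle_trans; [apply zpair_Rabs|].
    apply Rplus_le_compat; apply Ht.
  - intros n. eapply Rle_trans; [apply zpair_Rabs|]. apply Rplus_le_compat; apply Hlb.
  - intros n. unfold zpair. eapply filterlim_comp_2; [apply Hlim | apply Hlim |].
    apply (filterlim_plus (V := R_NormedModule)).
Qed.

Lemma Rabs_zsum f : zsummable f -> Rabs (zsum f) <= zsum (fun n => Rabs (f n)).
Proof.
  intros Hf. unfold zsum. eapply Rle_trans.
  - apply Series_Rabs. eapply ex_series_dominated; [|exact Hf].
    intros n. rewrite Rabs_Rabsolu. apply zpair_Rabs.
  - apply Series_le; [|exact Hf]. intros n; split; [apply Rabs_pos|apply zpair_Rabs].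
Qed.

(** The partial sums over [N] of the convolution are
    [sum_m (partial sum of the translate of f by m) * g m]. The inner factor
    tends to [zsum f] for each [m] and is bounded by the absolute sum of [f]
    uniformly in [m], so Tannery's theorem applies. *)
Lemma is_series_zsum_conv f g : zsummable f -> zsummable g ->
  (forall N, zsummable (fun m => f (N - m)%Z * g m)) /\
  is_series (zpair (fun N => zsum (fun m => f (N - m)%Z * g m))) (zsum f * zsum g).
Proof.
  intros Hf Hg.
  assert (Habsf := zsummable_abs f Hf).
  set (B := zsum (fun n => Rabs (f n))).
  (* Every finite symmetric block of a translate of [f] is bounded by the full absolute sum. *)
  assert (Sh : forall m, zsummable (fun n => f (n - m)%Z) /\ zsum (fun n => f (n - m)%Z) = zsum f).
  { intros m. exact (zsum_shift f (- m) Hf). }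
  assert (Bd : forall m M, sum_n (zpair (fun n => Rabs (f (n - m)%Z))) M <= B).
  { intros m M. destruct (zsum_shift _ (- m) Habsf) as [H1 H2].
    unfold B. rewrite <- H2. apply Series_ge_sum.
    - intros n; apply Rplus_le_le_0_compat; apply Rabs_pos.
    - now apply zsummable_ex. }
  assert (Bd' : forall m M, Rabs (sum_n (zpair (fun n => f (n - m)%Z)) M) <= B).
  { intros m M. eapply Rle_trans; [|apply (Bd m M)].
    induction M as [|M IH].
    - rewrite !sum_n_0. apply zpair_Rabs.
    - rewrite !sum_n_S. eapply Rle_trans; [apply Rabs_triang|].
      apply Rplus_le_compat; [exact IH | apply zpair_Rabs]. }
  assert (HB0 : 0 <= B).
  { eapply Rle_trans; [|apply (Bd' 0%Z 0%nat)]. apply Rabs_pos. }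
  assert (Hterm : forall N, zsummable (fun m => f (N - m)%Z * g m)).
  { intros N. apply zsummable_le with (fun m => B * Rabs (g m)).
    - intros m. rewrite Rabs_mult. apply Rmult_le_compat_r; [apply Rabs_pos|].
      assert (G : forall k, Rabs (f k) <= B).
      { intros k. eapply Rle_trans; [|apply (Bd (- k)%Z 0%nat)]. rewrite sum_n_0. unfold zpair.
        replace (Z.of_nat 0 - - k)%Z with k by lia.
        pose proof (Rabs_pos (f (-1 - Z.of_nat 0 - - k)%Z)). lra. }
      apply G.
    - apply zsummable_scal, zsummable_abs, Hg. }
  assert (Sw : forall M,
    sum_n (zpair (fun N => zsum (fun m => f (N - m)%Z * g m))) M =
    zsum (fun m => sum_n (zpair (fun n => f (n - m)%Z)) M * g m) :> R).
  { assert (Sw' : forall M, zsummable (fun m => sum_n (zpair (fun n => f (n - m)%Z)) M * g m) /\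
      sum_n (zpair (fun N => zsum (fun m => f (N - m)%Z * g m))) M =
      zsum (fun m => sum_n (zpair (fun n => f (n - m)%Z)) M * g m) :> R).
    { assert (P : forall n, zsummable (fun m => zpair (fun n => f (n - m)%Z) n * g m) /\
        zpair (fun N => zsum (fun m => f (N - m)%Z * g m)) n =
        zsum (fun m => zpair (fun n => f (n - m)%Z) n * g m)).
      { intros n.
        assert (X := zsummable_plus _ _ (Hterm (Z.of_nat n)) (Hterm (-1 - Z.of_nat n)%Z)).
        split.
        - eapply zsummable_ext; [|exact X]. intros i. unfold zpair. ring.
        - unfold zpair at 1. rewrite <- zsum_plus by apply Hterm.
          apply zsum_ext; intros m. unfold zpair. ring. }
      induction M as [|M [IH1 IH2]].
      - destruct (P 0%nat) as [P1 P2]. split.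
        + eapply zsummable_ext; [|exact P1]. intros i. now rewrite sum_n_0.
        + rewrite sum_n_0, P2. apply zsum_ext; intros m; now rewrite sum_n_0.
      - destruct (P (S M)) as [P1 P2]. split.
        + eapply zsummable_ext; [|exact (zsummable_plus _ _ IH1 P1)].
          intros i. rewrite sum_n_S. ring.
        + rewrite sum_n_S, P2, IH2. rewrite <- zsum_plus by assumption.
          apply zsum_ext; intros m; rewrite sum_n_S. ring. }
    intros M; apply Sw'. }
  split; [exact Hterm|]. unfold is_series.
  apply filterlim_ext with (fun M => zsum (fun m => sum_n (zpair (fun n => f (n - m)%Z)) M * g m)).
  { intros M; symmetry; apply Sw. }
  rewrite <- zsum_scal.
  apply (zsum_tannery eventually (fun M m => sum_n (zpair (fun n => f (n - m)%Z)) M * g m)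
     (fun m => zsum f * g m) (fun m => B * Rabs (g m))).
  - apply zsummable_scal, zsummable_abs, Hg.
  - apply filter_forall. intros M m. rewrite Rabs_mult.
    apply Rmult_le_compat_r; [apply Rabs_pos | apply Bd'].
  - intros m. rewrite Rabs_mult. apply Rmult_le_compat_r; [apply Rabs_pos|].
    now apply Rabs_zsum.
  - intros m. destruct (Sh m) as [S1 S2].
    assert (X : is_lim_seq (sum_n (zpair (fun n => f (n - m)%Z))) (zsum f)).
    { rewrite <- S2. apply Series_correct, zsummable_ex, S1. }
    apply (is_lim_seq_scal_r _ (g m)) in X. exact X.
Qed.

(** The products of theta and Lambert series below are computed coefficientwise:
    each coefficient is evaluated by a shift or shown to vanish by a reflection. *)
Lemma zsum_conv f g : zsummable f -> zsummable g ->
  zsummable (fun N => zsum (fun m => f (N - m)%Z * g m)) /\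
  zsum (fun N => zsum (fun m => f (N - m)%Z * g m)) = zsum f * zsum g.
Proof.
  intros Hf Hg.
  destruct (is_series_zsum_conv f g Hf Hg) as [Hm Hs].
  destruct (is_series_zsum_conv _ _ (zsummable_abs _ Hf) (zsummable_abs _ Hg)) as [_ Ha].
  split.
  - apply ex_series_dominated with (2 := ex_intro _ _ Ha).
    intros n. unfold zpair at 1. rewrite Rabs_pos_eq by (apply Rplus_le_le_0_compat; apply Rabs_pos).
    apply Rplus_le_compat; (eapply Rle_trans; [apply Rabs_zsum, Hm|]); apply Req_le, zsum_ext;
    intros m; apply Rabs_mult.
  - now apply is_series_unique.
Qed.

(** * Signs and integer powers *)

Definition zsign (n : Z) : R := if Z.even n then 1 else -1.

Lemma zsign_add a b : zsign (a + b) = zsign a * zsign b.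
Proof.
  unfold zsign. rewrite Z.even_add. destruct (Z.even a), (Z.even b); simpl; ring.
Qed.

Lemma zsign_mul_self a : zsign (a * a) = zsign a.
Proof. unfold zsign. rewrite Z.even_mul. now destruct (Z.even a). Qed.

Lemma zsign_double a : zsign (2 * a) = 1.
Proof. unfold zsign. now rewrite Z.even_mul. Qed.

Lemma zsign_opp a : zsign (- a) = zsign a.
Proof. unfold zsign. now rewrite Z.even_opp. Qed.

Lemma zsign_sqr a : zsign a * zsign a = 1.
Proof. unfold zsign. destruct (Z.even a); ring. Qed.

Lemma Rabs_zsign a : Rabs (zsign a) = 1.
Proof.
  unfold zsign. destruct (Z.even a); [apply Rabs_R1 | rewrite <- Rabs_R1; apply Rabs_Ropp].
Qed.

Lemma zsign_1 : zsign 1 = -1.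
Proof. reflexivity. Qed.

Lemma powerRZ_opp_base q n : q <> 0 -> powerRZ (- q) n = zsign n * powerRZ q n.
Proof.
  intros Hq. replace (- q) with (-1 * q) by ring. rewrite powerRZ_mult. f_equal.
  revert n. apply Z.bi_induction.
  - intros x y ->; tauto.
  - reflexivity.
  - intros n. unfold Z.succ. rewrite zsign_add, powerRZ_add by lra.
    rewrite zsign_1, powerRZ_1. split; intros; lra.
Qed.

Lemma powerRZ_pow_base q (k : nat) n : q <> 0 -> powerRZ (q ^ k) n = powerRZ q (Z.of_nat k * n).
Proof.
  intros Hq. induction k as [|k IH].
  - simpl. apply powerRZ_R1.
  - replace (Z.of_nat (S k) * n)%Z with (n + Z.of_nat k * n)%Z by lia.
    rewrite powerRZ_add by exact Hq. rewrite <- IH. simpl. apply powerRZ_mult.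
Qed.

Lemma Rabs_powerRZ q n : Rabs (powerRZ q n) = powerRZ (Rabs q) n.
Proof.
  destruct n as [|p|p]; simpl.
  - apply Rabs_R1.
  - now rewrite RPow_abs.
  - now rewrite Rabs_inv, RPow_abs.
Qed.

Lemma powerRZ_decr r a b : 0 < r <= 1 -> (a <= b)%Z -> powerRZ r b <= powerRZ r a.
Proof.
  intros Hr Hab. replace b with (a + (b - a))%Z by lia. rewrite powerRZ_add by lra.
  rewrite <- (Rmult_1_r (powerRZ r a)) at 2.
  apply Rmult_le_compat_l; [apply powerRZ_le; lra|].
  rewrite <- (Z2Nat.id (b - a)) by lia. rewrite <- pow_powerRZ.
  rewrite <- (pow1 (Z.to_nat (b - a))). apply pow_incr. lra.
Qed.

Lemma zsummable_geom r : 0 < r < 1 -> zsummable (fun n => powerRZ r (Z.abs n)).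
Proof.
  intros Hr.
  assert (G : ex_series (fun n => r ^ n)) by (apply ex_series_geom; rewrite Rabs_pos_eq; lra).
  apply zsummable_of_halves.
  - eapply ex_series_ext; [|exact G]. intros n.
    rewrite Rabs_powerRZ, Rabs_pos_eq, Z.abs_eq, pow_powerRZ by (lra || lia). reflexivity.
  - apply ex_series_dominated with (2 := G). intros n.
    rewrite Rabs_Rabsolu, Rabs_powerRZ, (Rabs_pos_eq r), pow_powerRZ by lra.
    apply powerRZ_decr; [lra|lia].
Qed.

(** Comparison with the bilateral geometric series: the quadratic exponents below
    all grow at least linearly. *)
Lemma zsummable_pow f r C d e : 0 < r < 1 -> 0 <= C ->
  (forall n, Rabs (f n) <= C * powerRZ r (e n)) -> (forall n, Z.abs n - d <= e n)%Z ->
  zsummable f.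
Proof.
  intros Hr HC Hf He.
  apply zsummable_le with (fun n => C * powerRZ r (- d) * powerRZ r (Z.abs n)).
  - intros n. eapply Rle_trans; [apply Hf|]. rewrite Rmult_assoc.
    apply Rmult_le_compat_l; [exact HC|]. rewrite <- powerRZ_add by lra.
    apply powerRZ_decr; [lra|]. specialize (He n). lia.
  - apply (zsummable_scal (C * powerRZ r (- d))), zsummable_geom, Hr.
Qed.

Lemma Zabs_le_sqr n : (Z.abs n <= n * n)%Z.
Proof. nia. Qed.

(** * Quadratic identities between theta series *)

(** Jacobi's theta_3(q); theta_4(q) is [theta (- q)]. *)
Definition theta (q : R) : R := zsum (fun n => powerRZ q (n * n)).

Lemma zsummable_theta q : 0 < Rabs q < 1 -> zsummable (fun n => powerRZ q (n * n)).
Proof.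
  intros Hq. apply zsummable_pow with (Rabs q) 1 0%Z (fun n => (n * n)%Z); try lra.
  - intros n. rewrite Rabs_powerRZ. lra.
  - intros n. pose proof (Zabs_le_sqr n). lia.
Qed.

Lemma Rabs_pos_neq_0 q : 0 < Rabs q -> q <> 0.
Proof. intros H ->. rewrite Rabs_R0 in H. lra. Qed.

Lemma theta_parity q : 0 < Rabs q < 1 ->
  theta q = theta (q ^ 4) + zsum (fun n => powerRZ q ((2 * n + 1) * (2 * n + 1))).
Proof.
  intros Hq. destruct (zsum_split_parity _ (zsummable_theta q Hq)) as (_ & _ & E).
  unfold theta. rewrite E. f_equal. apply zsum_ext. intros n.
  rewrite powerRZ_pow_base by now apply Rabs_pos_neq_0. f_equal. lia.
Qed.

Lemma theta_add_theta_opp q : 0 < Rabs q < 1 -> theta q + theta (- q) = 2 * theta (q ^ 4).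
Proof.
  intros Hq. rewrite (theta_parity q Hq), (theta_parity (- q)) by now rewrite Rabs_Ropp.
  replace ((- q) ^ 4) with (q ^ 4) by ring.
  rewrite (zsum_ext (fun n => powerRZ (- q) _)
    (fun n => -1 * powerRZ q ((2 * n + 1) * (2 * n + 1)))).
  - rewrite zsum_scal. ring.
  - intros n. rewrite powerRZ_opp_base by now apply Rabs_pos_neq_0.
    now rewrite zsign_mul_self, zsign_add, zsign_double, zsign_1, Rmult_1_l.
Qed.

(** The coefficient at [N = x + y] of the product collects
    [(-1)^y q^(x^2 + y^2)]. For [N] odd, swapping [x] and [y] reverses the sign,
    so it vanishes; for [N = 2 i], writing [x = i - m, y = i + m] gives
    [x^2 + y^2 = 2 i^2 + 2 m^2]. This is the geometric-mean half of the AGM step. *)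
Lemma theta_mul_theta_opp q : 0 < Rabs q < 1 -> theta q * theta (- q) = theta (- q ^ 2) ^ 2.
Proof.
  intros Hq. assert (Hq0 := Rabs_pos_neq_0 q (proj1 Hq)).
  assert (Hm : 0 < Rabs (- q) < 1) by now rewrite Rabs_Ropp.
  destruct (zsum_conv _ _ (zsummable_theta q Hq) (zsummable_theta (- q) Hm)) as [Hs E].
  destruct (is_series_zsum_conv _ _ (zsummable_theta q Hq) (zsummable_theta (- q) Hm)) as [Hc _].
  cbv beta in Hc, Hs, E. unfold theta at 1 2. rewrite <- E. clear E.
  destruct (zsum_split_parity _ Hs) as (_ & _ & ->).
  rewrite (zsum_ext _ (fun i => theta (- q ^ 2) * powerRZ (- q ^ 2) (i * i))).
  - rewrite zsum_scal.
    rewrite (zsum_ext (fun n => zsum _) (fun n => 0 * 0)).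
    + rewrite zsum_scal. unfold theta. ring.
    + intros i. set (c := zsum _).
      assert (c = -1 * c); [|lra].
      unfold c at 1. rewrite <- (zsum_reflect _ (2 * i + 1) (Hc (2 * i + 1)%Z)).
      unfold c. rewrite <- zsum_scal.
      apply zsum_ext. intros m.
      rewrite !powerRZ_opp_base, !zsign_mul_self by exact Hq0.
      replace (2 * i + 1 - (2 * i + 1 - m))%Z with m by lia.
      unfold Z.sub at 1. rewrite !zsign_add, zsign_double, zsign_opp, zsign_1. ring.
  - intros i. rewrite <- (proj2 (zsum_shift _ i (Hc (2 * i)%Z))).
    unfold theta. rewrite Rmult_comm, <- zsum_scal. apply zsum_ext. intros m.
    assert (q ^ 2 <> 0) by now apply pow_nonzero.
    rewrite !powerRZ_opp_base, !zsign_mul_self, !powerRZ_pow_base, !zsign_add by assumption.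
    replace (zsign i * powerRZ q (Z.of_nat 2 * (i * i)) * (zsign m * powerRZ q (Z.of_nat 2 * (m * m))))
      with (zsign m * zsign i * (powerRZ q (Z.of_nat 2 * (i * i)) * powerRZ q (Z.of_nat 2 * (m * m)))) by ring.
    rewrite <- powerRZ_add by assumption.
    match goal with |- ?a * (?b * ?c) = _ => replace (a * (b * c)) with (b * (a * c)) by ring end.
    rewrite <- powerRZ_add by assumption. do 2 f_equal. lia.
Qed.

(** Changing [q] to [- q] multiplies the coefficient at [N] of the square by
    [(-1)^N], so only even [N] survive in the sum. This is the arithmetic-mean
    half of the AGM step. *)
Lemma theta_sqr_add_theta_opp_sqr q : 0 < Rabs q < 1 ->
  theta q ^ 2 + theta (- q) ^ 2 = 2 * theta (q ^ 2) ^ 2.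
Proof.
  intros Hq. assert (Hq0 := Rabs_pos_neq_0 q (proj1 Hq)).
  assert (Hm : 0 < Rabs (- q) < 1) by now rewrite Rabs_Ropp.
  destruct (zsum_conv _ _ (zsummable_theta q Hq) (zsummable_theta q Hq)) as [Hs E].
  destruct (zsum_conv _ _ (zsummable_theta (- q) Hm) (zsummable_theta (- q) Hm)) as [Hs' E'].
  destruct (is_series_zsum_conv _ _ (zsummable_theta q Hq) (zsummable_theta q Hq)) as [Hc _].
  replace (theta q ^ 2) with (theta q * theta q) by ring.
  replace (theta (- q) ^ 2) with (theta (- q) * theta (- q)) by ring.
  unfold theta at 1 2 3 4. rewrite <- E, <- E'. clear E E'.
  set (d := fun N => zsum (fun m => powerRZ q ((N - m) * (N - m)) * powerRZ q (m * m))).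
  change (zsummable d) in Hs. fold d.
  assert (Hd : forall N, zsign N * d N =
    zsum (fun m => powerRZ (- q) ((N - m) * (N - m)) * powerRZ (- q) (m * m))).
  { intros N. unfold d. rewrite <- zsum_scal. apply zsum_ext. intros m.
    rewrite !powerRZ_opp_base, !zsign_mul_self by exact Hq0.
    replace (zsign N) with (zsign (N - m) * zsign m); [ring|].
    rewrite <- zsign_add. f_equal. lia. }
  rewrite <- (zsum_ext _ _ Hd).
  apply (zsummable_ext _ (fun N => zsign N * d N)) in Hs'; [|intros N; symmetry; apply Hd].
  destruct (zsum_split_parity _ Hs) as (_ & _ & ->).
  destruct (zsum_split_parity _ Hs') as (_ & _ & ->).
  rewrite (zsum_ext (fun n => zsign (2 * n) * _) (fun n => d (2 * n)%Z))
    by (intros n; rewrite zsign_double; ring).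
  rewrite (zsum_ext (fun n => zsign (2 * n + 1) * _) (fun n => -1 * d (2 * n + 1)%Z))
    by (intros n; rewrite zsign_add, zsign_double, zsign_1; ring).
  rewrite zsum_scal.
  rewrite (zsum_ext (fun n => d (2 * n)%Z) (fun i => theta (q ^ 2) * powerRZ (q ^ 2) (i * i))).
  - rewrite zsum_scal. unfold theta. ring.
  - intros i. unfold d. rewrite <- (proj2 (zsum_shift _ i (Hc (2 * i)%Z))).
    unfold theta. rewrite Rmult_comm, <- zsum_scal. apply zsum_ext. intros m.
    rewrite !powerRZ_pow_base by assumption.
    rewrite <- !powerRZ_add by assumption. f_equal. lia.
Qed.

(** * The bilateral Lambert series times a theta series *)

(** Half of the series [1 + 2 sum_m chi(m) q^m / (1 - q^m)], where
    [chi(2 n + 1) = (-1)^(n/2)] is the character modulo 8 attached to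
    [x^2 + 2 y^2]: expanding in powers of [q^j] and summing over [m] gives
    [(q^j + q^(3 j)) / (1 + q^(4 j))], the terms at [j] and [- j] below together. *)
Definition lambert_sum (q : R) : R := zsum (fun j => powerRZ q j / (1 + powerRZ q (4 * j))).

Lemma powerRZ_even_pos q n : q <> 0 -> 0 < powerRZ q (2 * n).
Proof.
  intros Hq. rewrite <- (powerRZ_pow_base q 2) by exact Hq.
  apply powerRZ_lt. apply pow2_gt_0, Hq.
Qed.

Lemma lambert_sum_den_gt_1 q n : q <> 0 -> 1 < 1 + powerRZ q (4 * n).
Proof.
  intros Hq. replace (4 * n)%Z with (2 * (2 * n))%Z by lia.
  pose proof (powerRZ_even_pos q (2 * n) Hq). lra.
Qed.

Lemma lambert_sum_term_bound q j : 0 < Rabs q < 1 ->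
  Rabs (powerRZ q j / (1 + powerRZ q (4 * j))) <= powerRZ (Rabs q) (Z.abs j).
Proof.
  intros Hq. assert (Hq0 := Rabs_pos_neq_0 q (proj1 Hq)).
  assert (D := lambert_sum_den_gt_1 q j Hq0).
  rewrite Rabs_div by lra. rewrite (Rabs_pos_eq (1 + _)) by lra.
  apply Rle_div_l; [lra|]. rewrite Rabs_powerRZ.
  replace (powerRZ q (4 * j)) with (powerRZ (Rabs q) (4 * j)).
  2:{ rewrite <- Rabs_powerRZ. apply Rabs_pos_eq. lra. }
  rewrite Rmult_plus_distr_l, Rmult_1_r, <- powerRZ_add by lra.
  pose proof (powerRZ_lt (Rabs q) (Z.abs j) (proj1 Hq)).
  pose proof (powerRZ_lt (Rabs q) (Z.abs j + 4 * j) (proj1 Hq)).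
  destruct (Z_le_gt_dec 0 j).
  - rewrite Z.abs_eq in * by lia. lra.
  - assert (powerRZ (Rabs q) j <= powerRZ (Rabs q) (Z.abs j + 4 * j)); [|lra].
    apply powerRZ_decr; [lra|lia].
Qed.

Lemma zsummable_lambert_sum q : 0 < Rabs q < 1 ->
  zsummable (fun j => powerRZ q j / (1 + powerRZ q (4 * j))).
Proof.
  intros Hq. apply zsummable_le with (2 := zsummable_geom _ Hq).
  intros j. now apply lambert_sum_term_bound.
Qed.

Lemma lambert_sum_add_opp q : 0 < Rabs q < 1 ->
  lambert_sum q + lambert_sum (- q) = 2 * lambert_sum (q ^ 2).
Proof.
  intros Hq. assert (Hq0 := Rabs_pos_neq_0 q (proj1 Hq)).
  assert (Hm : 0 < Rabs (- q) < 1) by now rewrite Rabs_Ropp.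
  destruct (zsum_split_parity _ (zsummable_lambert_sum q Hq)) as (_ & _ & E).
  destruct (zsum_split_parity _ (zsummable_lambert_sum (- q) Hm)) as (_ & _ & E').
  unfold lambert_sum. rewrite E, E'.
  rewrite (zsum_ext (fun n => powerRZ (- q) (2 * n + 1) / _)
     (fun n => -1 * (powerRZ q (2 * n + 1) / (1 + powerRZ q (4 * (2 * n + 1)))))).
  2:{ intros n. rewrite !powerRZ_opp_base by exact Hq0.
    replace (4 * (2 * n + 1))%Z with (2 * (2 * (2 * n + 1)))%Z by lia.
    rewrite zsign_add, !zsign_double, zsign_1, !Rmult_1_l. unfold Rdiv; ring. }
  rewrite zsum_scal.
  rewrite !(zsum_ext (fun n => powerRZ _ (2 * n) / _)
     (fun n => powerRZ (q ^ 2) n / (1 + powerRZ (q ^ 2) (4 * n)))).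
  - ring.
  - intros n. rewrite !powerRZ_opp_base, !powerRZ_pow_base by exact Hq0.
    replace (4 * (2 * n))%Z with (2 * (4 * n))%Z by lia.
    now rewrite !zsign_double, !Rmult_1_l.
  - intros n. rewrite !powerRZ_pow_base by exact Hq0.
    replace (4 * (2 * n))%Z with (2 * (4 * n))%Z by lia. reflexivity.
Qed.

(** Up to the factor [q^N], the [N]-th coefficient of the convolution product
    [lambert_sum q * theta (- q)]. *)
Definition lambert_theta_coef (q : R) (N : Z) : R :=
  zsum (fun m => zsign m * powerRZ q (m * m - m) / (1 + powerRZ q (4 * (N - m)))).

Lemma lambert_theta_coef_bound q N m : q <> 0 ->
  Rabs (zsign m * powerRZ q (m * m - m) / (1 + powerRZ q (4 * (N - m)))) <=
  powerRZ (Rabs q) (m * m - m).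
Proof.
  intros Hq0. assert (D := lambert_sum_den_gt_1 q (N - m) Hq0).
  rewrite Rabs_div, Rabs_mult, Rabs_zsign, Rmult_1_l by lra.
  rewrite (Rabs_pos_eq (1 + _)), Rabs_powerRZ by lra.
  apply Rle_div_l; [lra|].
  rewrite <- (Rmult_1_r (powerRZ (Rabs q) (m * m - m))) at 1.
  apply Rmult_le_compat_l; [|lra]. apply powerRZ_le. now apply Rabs_pos_lt.
Qed.

Lemma zsummable_lambert_theta_coef q N : 0 < Rabs q < 1 ->
  zsummable (fun m => zsign m * powerRZ q (m * m - m) / (1 + powerRZ q (4 * (N - m)))).
Proof.
  intros Hq. apply zsummable_pow with (Rabs q) 1 1%Z (fun m => (m * m - m)%Z); try lra.
  - intros m. rewrite Rmult_1_l. apply lambert_theta_coef_bound. now apply Rabs_pos_neq_0.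
  - intros m. nia.
Qed.

(** Shifting [m] by 2 in the sum for [N + 2] restores the denominators of the sum
    for [N] and multiplies the numerators by [q^(4 m + 2)], that is by
    [q^(4 N + 2) / y] with [y = q^(4 (N - m))]. In
    [1 / (y (1 + y)) = 1 / y - 1 / (1 + y)] the first part produces a theta series
    that vanishes by symmetry, the second the sum for [N]. *)
Lemma lambert_theta_coef_step q N : 0 < Rabs q < 1 ->
  lambert_theta_coef q (N + 2) = - powerRZ q (4 * N + 2) * lambert_theta_coef q N.
Proof.
  intros Hq. assert (Hq0 := Rabs_pos_neq_0 q (proj1 Hq)).
  unfold lambert_theta_coef.
  rewrite <- (proj2 (zsum_shift _ 2 (zsummable_lambert_theta_coef q (N + 2) Hq))).
  assert (Hsumm : zsummable (fun m => zsign m * powerRZ q (m * m + 3 * m))).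
  { apply zsummable_pow with (Rabs q) 1 4%Z (fun m => (m * m + 3 * m)%Z); try lra.
    - intros m. rewrite Rabs_mult, Rabs_zsign, Rabs_powerRZ. lra.
    - intros m. pose proof (Z.square_nonneg (m + 2)). nia. }
  (* [m |-> -3 - m] preserves the exponent and reverses the sign. *)
  assert (Hzero : zsum (fun m => zsign m * powerRZ q (m * m + 3 * m)) = 0).
  { assert (E := zsum_reflect _ (-3) Hsumm). cbv beta in E.
    rewrite (zsum_ext _ (fun m => -1 * (zsign m * powerRZ q (m * m + 3 * m)))) in E.
    - rewrite zsum_scal in E. lra.
    - intros m. unfold Z.sub. rewrite zsign_add, zsign_opp.
      replace ((-3 + - m) * (-3 + - m) + 3 * (-3 + - m))%Z with (m * m + 3 * m)%Z by lia.
      change (zsign (-3)) with (-1). ring. }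
  rewrite <- zsum_scal.
  rewrite <- (Rplus_0_l (zsum (fun n => - powerRZ q (4 * N + 2) * _))).
  rewrite <- (Rmult_0_r (powerRZ q 2)), <- Hzero at 1.
  rewrite <- zsum_scal, <- zsum_plus.
  - apply zsum_ext. intros m. assert (D := lambert_sum_den_gt_1 q (N - m) Hq0).
    replace (4 * (N + 2 - (m + 2)))%Z with (4 * (N - m))%Z by lia.
    replace (zsign (m + 2)) with (zsign m) by (rewrite zsign_add; change (zsign 2) with 1; ring).
    replace ((m + 2) * (m + 2) - (m + 2))%Z with ((m * m - m) + (4 * m) + 2)%Z by lia.
    replace (m * m + 3 * m)%Z with ((m * m - m) + 4 * m)%Z by lia.
    replace (4 * N + 2)%Z with (4 * (N - m) + 4 * m + 2)%Z by lia.
    rewrite !powerRZ_add by exact Hq0. field. lra.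
  - now apply zsummable_scal.
  - apply zsummable_scal, zsummable_lambert_theta_coef, Hq.
Qed.

Lemma lambert_theta_coef_arith q N i : 0 < Rabs q < 1 ->
  lambert_theta_coef q (N + 2 * i) = zsign i * powerRZ q (4 * i * i + (4 * N - 2) * i) * lambert_theta_coef q N.
Proof.
  intros Hq. assert (Hq0 := Rabs_pos_neq_0 q (proj1 Hq)).
  revert i. apply Z.bi_induction.
  - intros x y ->; tauto.
  - rewrite Z.mul_0_r, Z.add_0_r. replace (4 * 0 * 0 + (4 * N - 2) * 0)%Z with 0%Z by lia.
    change (zsign 0) with 1. rewrite powerRZ_O. ring.
  - intros i.
    replace (N + 2 * Z.succ i)%Z with (N + 2 * i + 2)%Z by lia.
    rewrite (lambert_theta_coef_step q _ Hq). unfold Z.succ. rewrite zsign_add, zsign_1.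
    replace (4 * (i + 1) * (i + 1) + (4 * N - 2) * (i + 1))%Z
      with ((4 * (N + 2 * i) + 2) + (4 * i * i + (4 * N - 2) * i))%Z by lia.
    rewrite (powerRZ_add q (4 * (N + 2 * i) + 2)) by exact Hq0.
    assert (P := powerRZ_NOR q (4 * (N + 2 * i) + 2) Hq0).
    split; intros E.
    + rewrite E. ring.
    + apply (Rmult_eq_reg_l (powerRZ q (4 * (N + 2 * i) + 2))); [|exact P]. lra.
Qed.

(** The coefficients with even [N] are all multiples of the one at 0 and add up to
    a theta series; those with odd [N] add up to a multiple of
    [sum_n (-1)^n q^((2 n + 1)^2)], which is 0 because [n |-> -1 - n] reverses
    its sign. The right-hand side is visibly even in [q], by
    [lambert_theta_coef_opp]. *)
Lemma lambert_sum_mul_theta_opp q : 0 < Rabs q < 1 ->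
  lambert_sum q * theta (- q) = theta (- q ^ 4) * lambert_theta_coef q 0.
Proof.
  intros Hq. assert (Hq0 := Rabs_pos_neq_0 q (proj1 Hq)).
  assert (Hm : 0 < Rabs (- q) < 1) by now rewrite Rabs_Ropp.
  destruct (zsum_conv _ _ (zsummable_lambert_sum q Hq) (zsummable_theta (- q) Hm)) as [Hs E].
  unfold lambert_sum, theta at 1. rewrite <- E. clear E.
  assert (Ht : forall N, zsum (fun m => powerRZ q (N - m) / (1 + powerRZ q (4 * (N - m)))
     * powerRZ (- q) (m * m)) = powerRZ q N * lambert_theta_coef q N).
  { intros N. unfold lambert_theta_coef. rewrite <- zsum_scal. apply zsum_ext. intros m.
    rewrite powerRZ_opp_base, zsign_mul_self by exact Hq0.
    replace (powerRZ q (N - m)) with (powerRZ q N * powerRZ q (- m))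
      by (rewrite <- powerRZ_add by exact Hq0; reflexivity).
    replace (m * m - m)%Z with (m * m + - m)%Z by lia. rewrite (powerRZ_add q (m * m)) by exact Hq0.
    unfold Rdiv; ring. }
  rewrite (zsum_ext _ _ Ht). apply (zsummable_ext _ _ Ht) in Hs.
  destruct (zsum_split_parity _ Hs) as (_ & _ & ->).
  rewrite (zsum_ext (fun n => powerRZ q (2 * n + 1) * _)
     (fun n => lambert_theta_coef q 1 * (zsign n * powerRZ q ((2 * n + 1) * (2 * n + 1))))).
  2:{ intros n. replace (2 * n + 1)%Z with (1 + 2 * n)%Z at 2 by lia.
    rewrite lambert_theta_coef_arith by exact Hq.
    replace ((2 * n + 1) * (2 * n + 1))%Z with ((2 * n + 1) + (4 * n * n + (4 * 1 - 2) * n))%Z by lia.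
    rewrite (powerRZ_add q (2 * n + 1)) by exact Hq0. ring. }
  rewrite (zsum_ext (fun n => powerRZ q (2 * n) * _)
     (fun n => lambert_theta_coef q 0 * powerRZ (- q ^ 4) (n * n))).
  2:{ intros n. replace (2 * n)%Z with (0 + 2 * n)%Z at 2 by lia.
    rewrite lambert_theta_coef_arith by exact Hq.
    rewrite powerRZ_opp_base, zsign_mul_self, powerRZ_pow_base by (try apply pow_nonzero; exact Hq0).
    replace (Z.of_nat 4 * (n * n))%Z with (2 * n + (4 * n * n + (4 * 0 - 2) * n))%Z by lia.
    rewrite (powerRZ_add q (2 * n)) by exact Hq0. ring. }
  rewrite !zsum_scal.
  assert (Hzero : zsum (fun n => zsign n * powerRZ q ((2 * n + 1) * (2 * n + 1))) = 0).
  { assert (E := zsum_flip (fun n => zsign n * powerRZ q ((2 * n + 1) * (2 * n + 1)))).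
    rewrite (zsum_ext _ (fun n => -1 * (zsign n * powerRZ q ((2 * n + 1) * (2 * n + 1))))) in E.
    - rewrite zsum_scal in E. lra.
    - intros n. unfold Z.sub. rewrite zsign_add, zsign_opp.
      replace ((2 * (-1 + - n) + 1) * (2 * (-1 + - n) + 1))%Z with ((2 * n + 1) * (2 * n + 1))%Z by lia.
      change (zsign (-1)) with (-1). ring. }
  rewrite Hzero. unfold theta. ring.
Qed.

Lemma lambert_theta_coef_opp q : q <> 0 -> lambert_theta_coef (- q) 0 = lambert_theta_coef q 0.
Proof.
  intros Hq0. apply zsum_ext. intros m.
  rewrite !powerRZ_opp_base by exact Hq0.
  replace (4 * (0 - m))%Z with (2 * (2 * - m))%Z by lia. rewrite zsign_double.
  unfold Z.sub. rewrite !zsign_add, zsign_mul_self, zsign_opp.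
  replace (zsign m * zsign m) with 1 by now rewrite zsign_sqr. now rewrite !Rmult_1_l.
Qed.

(** Evenness of [lambert_sum q * theta (- q)] gives
    [lambert_sum q * theta (- q) = lambert_sum (- q) * theta q]; adding
    [lambert_sum q * theta q] to both sides and using the two formulas for the
    even parts yields the claim. *)
Lemma lambert_sum_step q : 0 < Rabs q < 1 ->
  lambert_sum q * theta (q ^ 4) = theta q * lambert_sum (q ^ 2).
Proof.
  intros Hq. assert (Hq0 := Rabs_pos_neq_0 q (proj1 Hq)).
  assert (Hm : 0 < Rabs (- q) < 1) by now rewrite Rabs_Ropp.
  assert (E1 := lambert_sum_mul_theta_opp q Hq).
  assert (E2 := lambert_sum_mul_theta_opp (- q) Hm).
  rewrite lambert_theta_coef_opp in E2 by exact Hq0. rewrite Ropp_involutive in E2.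
  replace ((- q) ^ 4) with (q ^ 4) in E2 by ring. rewrite <- E1 in E2.
  assert (E3 := theta_add_theta_opp q Hq). assert (E4 := lambert_sum_add_opp q Hq).
  replace (theta (q ^ 4)) with ((theta q + theta (- q)) / 2) by lra.
  replace (lambert_sum (q ^ 2)) with ((lambert_sum q + lambert_sum (- q)) / 2) by lra.
  lra.
Qed.

(** * Behaviour at 0 and iterated squaring *)

Lemma zsum_single f : (forall n, n <> 0%Z -> f n = 0) -> zsum f = f 0%Z.
Proof.
  intros H. apply is_series_unique. unfold is_series.
  assert (Hs : forall N, sum_n (zpair f) N = f 0%Z :> R).
  2:{ apply filterlim_ext with (fun _ => f 0%Z); [intros N; symmetry; apply Hs|].
    apply filterlim_const. }
  intros N. induction N as [|N IH].
  - rewrite sum_n_0. unfold zpair. rewrite (H (-1 - _)%Z) by lia. simpl. ring.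
  - rewrite sum_n_S. unfold zpair at 2.
    rewrite (H (Z.of_nat (S N))), (H (-1 - _)%Z) by lia. rewrite IH. ring.
Qed.

Lemma at_right_0_lt d : 0 < d -> at_right 0 (fun x => 0 < x < d).
Proof.
  intros Hd. exists (mkposreal d Hd). intros y Hy Hy0. split; [exact Hy0|].
  unfold ball in Hy; simpl in Hy; unfold AbsRing_ball in Hy; simpl in Hy.
  unfold abs, minus, plus, opp in Hy; simpl in Hy. apply Rabs_def2 in Hy. lra.
Qed.

(** As [x] tends to 0, a series dominated by [x^|n|] keeps only its term [n = 0]. *)
Lemma zsum_lim_0 (f : R -> Z -> R) (l : R) :
  (forall x n, 0 < x < 1 -> Rabs (f x n) <= powerRZ x (Z.abs n)) ->
  (forall x, 0 < x < 1 -> f x 0%Z = l) ->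
  filterlim (fun x => zsum (f x)) (at_right 0) (locally l).
Proof.
  intros Hb H0.
  set (l' := fun n : Z => if Z.eq_dec n 0 then l else 0).
  assert (Hl : zsum l' = l).
  { rewrite zsum_single; [reflexivity|]. intros n Hn. unfold l'.
    destruct (Z.eq_dec n 0); [contradiction | reflexivity]. }
  assert (Hnear : at_right 0 (fun x => 0 < x < 1 / 2)) by (apply at_right_0_lt; lra).
  rewrite <- Hl.
  apply (zsum_tannery (at_right 0) f l' (fun n => powerRZ (1 / 2) (Z.abs n))).
  - apply zsummable_geom. lra.
  - revert Hnear. apply filter_imp. intros x Hx n. eapply Rle_trans; [apply Hb; lra|].
    rewrite <- (Z2Nat.id (Z.abs n)) by lia. rewrite <- !pow_powerRZ. apply pow_incr. lra.
  - intros n. unfold l'. destruct (Z.eq_dec n 0) as [->|Hn].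
    + rewrite <- (H0 (1 / 2)) by lra. apply Hb. lra.
    + rewrite Rabs_R0. apply powerRZ_le. lra.
  - intros n. unfold l'. destruct (Z.eq_dec n 0) as [->|Hn].
    + apply filterlim_ext_loc with (fun _ => l); [|apply filterlim_const].
      revert Hnear. apply filter_imp. intros x Hx. symmetry; apply H0. lra.
    + apply filterlim_locally. intros eps.
      generalize (filter_and _ _ Hnear (at_right_0_lt eps (cond_pos eps))).
      apply filter_imp. intros x [Hx [_ Hxe]].
      unfold ball; simpl; unfold AbsRing_ball; simpl; unfold abs, minus, plus, opp; simpl.
      rewrite Ropp_0, Rplus_0_r.
      eapply Rle_lt_trans; [apply Hb; lra|]. eapply Rle_lt_trans; [|exact Hxe].
      rewrite <- (powerRZ_1 x) at 2. apply powerRZ_decr; [lra|lia].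
Qed.

Lemma sqr_unit_interval x : 0 < x < 1 -> 0 < x ^ 2 < 1.
Proof. nra. Qed.

Lemma theta_lim_0 s : s = 1 \/ s = -1 ->
  filterlim (fun x => theta (s * x)) (at_right 0) (locally 1).
Proof.
  intros Hs.
  apply (zsum_lim_0 (fun x n => powerRZ (s * x) (n * n))).
  - intros x n Hx. rewrite Rabs_powerRZ.
    replace (Rabs (s * x)) with x.
    + apply powerRZ_decr; [lra | apply Zabs_le_sqr].
    + rewrite Rabs_mult. destruct Hs as [-> | ->]; rewrite ?(Rabs_left (-1)), ?Rabs_R1, Rabs_pos_eq; lra.
  - intros x _. reflexivity.
Qed.

Lemma lambert_sum_lim_0 : filterlim lambert_sum (at_right 0) (locally (1 / 2)).
Proof.
  apply (zsum_lim_0 (fun x j => powerRZ x j / (1 + powerRZ x (4 * j)))).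
  - intros x n Hx. rewrite <- (Rabs_pos_eq x) at 3 by lra.
    apply lambert_sum_term_bound. rewrite Rabs_pos_eq; lra.
  - intros x _. simpl. lra.
Qed.

Definition nome_iter (q : R) (n : nat) : R := q ^ (2 ^ n).

Lemma nome_iter_0 q : nome_iter q 0 = q.
Proof. unfold nome_iter. simpl. ring. Qed.

Lemma nome_iter_S q n : nome_iter q (S n) = nome_iter q n ^ 2.
Proof. unfold nome_iter. rewrite <- pow_mult. f_equal. simpl. lia. Qed.

Lemma nome_iter_bounds q n : 0 < q < 1 -> 0 < nome_iter q n < 1.
Proof.
  intros Hq. unfold nome_iter. split; [apply pow_lt; lra|].
  apply pow_lt_1_compat; [lra|]. apply Nat.neq_0_lt_0, Nat.pow_nonzero; lia.
Qed.

Lemma nome_iter_lim q : 0 < q < 1 -> filterlim (nome_iter q) eventually (at_right 0).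
Proof.
  intros Hq P [d HP].
  assert (L : is_lim_seq (nome_iter q) 0).
  { apply (is_lim_seq_subseq (fun n => q ^ n) 0 (fun n => (2 ^ n)%nat)).
    - apply eventually_subseq. intros n. simpl. pose proof (Nat.pow_nonzero 2 n). lia.
    - apply is_lim_seq_geom. rewrite Rabs_pos_eq; lra. }
  destruct (proj1 (filterlim_locally _ _) L d) as [N HN].
  exists N. intros n Hn. apply HP; [now apply HN | apply nome_iter_bounds, Hq].
Qed.

Lemma Rabs_unit_interval q : 0 < q < 1 -> 0 < Rabs q < 1.
Proof. intros Hq. rewrite Rabs_pos_eq; lra. Qed.

Lemma theta_nome_lim q s : 0 < q < 1 -> s = 1 \/ s = -1 ->
  is_lim_seq (fun n => theta (s * nome_iter q n)) 1.
Proof.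
  intros Hq Hs. exact (filterlim_comp _ _ _ _ (fun x => theta (s * x)) _ _ _
    (nome_iter_lim q Hq) (theta_lim_0 s Hs)).
Qed.

Lemma theta_ge_1 q : 0 < q < 1 -> 1 <= theta q.
Proof.
  intros Hq. unfold theta, zsum.
  eapply Rle_trans; [|apply (Series_ge_sum _ 0)].
  - rewrite sum_n_0. unfold zpair. simpl. lra.
  - intros n. unfold zpair. apply Rplus_le_le_0_compat; apply powerRZ_le; lra.
  - apply zsummable_ex, zsummable_theta, Rabs_unit_interval, Hq.
Qed.

(** The analytic form of the count of representations by [x^2 + 2 y^2].
    By [lambert_sum_step], the ratio of the two sides is unchanged by
    [q |-> q^2], hence it equals its limit 1 at 0. *)
Theorem lambert_sum_eq_theta q : 0 < q < 1 -> 2 * lambert_sum q = theta q * theta (q ^ 2).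
Proof.
  intros Hq.
  set (ratio := fun x => lambert_sum x / (theta x * theta (x ^ 2))).
  assert (Hinv : forall n, ratio q = ratio (nome_iter q n)).
  { induction n as [|n IH].
    - unfold nome_iter. simpl. now rewrite Rmult_1_r.
    - rewrite IH, nome_iter_S. assert (Hx := nome_iter_bounds q n Hq).
      set (x := nome_iter q n) in *. clearbody x. unfold ratio.
      assert (St := lambert_sum_step x (Rabs_unit_interval x Hx)).
      replace ((x ^ 2) ^ 2) with (x ^ 4) by ring.
      assert (Hx2 : 0 < x ^ 2 < 1) by nra. assert (Hx4 : 0 < x ^ 4 < 1).
      { replace (x ^ 4) with (x ^ 2 * x ^ 2) by ring. nra. }
      pose proof (theta_ge_1 x Hx). pose proof (theta_ge_1 _ Hx2). pose proof (theta_ge_1 _ Hx4).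
      apply (Rmult_eq_reg_r (theta x * theta (x ^ 2) * theta (x ^ 4))).
      2:{ apply Rgt_not_eq. repeat apply Rmult_lt_0_compat; lra. }
      transitivity (lambert_sum x * theta (x ^ 4)); [field; lra|].
      rewrite St. field; lra. }
  assert (L : is_lim_seq (fun n => ratio (nome_iter q n)) (1 / 2 / (1 * 1))).
  { apply is_lim_seq_div'; [| |lra].
    - exact (filterlim_comp _ _ _ _ _ _ _ _ (nome_iter_lim q Hq) lambert_sum_lim_0).
    - assert (T := theta_nome_lim q 1 Hq (or_introl eq_refl)).
      apply is_lim_seq_mult'.
      + eapply is_lim_seq_ext; [|exact T]. intros n. cbv beta. now rewrite Rmult_1_l.
      + apply is_lim_seq_incr_1 in T. eapply is_lim_seq_ext; [|exact T].
        intros n. cbv beta. now rewrite Rmult_1_l, nome_iter_S. }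
  assert (L' : is_lim_seq (fun n => ratio (nome_iter q n)) (ratio q)).
  { eapply is_lim_seq_ext; [|apply is_lim_seq_const]. intros n. apply Hinv. }
  apply is_lim_seq_unique in L. apply is_lim_seq_unique in L'. rewrite L in L'.
  injection L' as L'. unfold ratio in L'.
  pose proof (theta_ge_1 q Hq). assert (Hq2 : 0 < q ^ 2 < 1) by nra.
  pose proof (theta_ge_1 _ Hq2).
  replace (lambert_sum q) with (lambert_sum q / (theta q * theta (q ^ 2)) * (theta q * theta (q ^ 2)))
    by (field; lra).
  rewrite <- L'. field.
Qed.

Lemma theta_opp_bounds q : 0 < q < 1 -> 0 <= theta (- q) <= theta q.
Proof.
  intros Hq. assert (T := theta_ge_1 q Hq). split.
  - assert (E := theta_mul_theta_opp q (Rabs_unit_interval q Hq)).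
    apply (Rmult_le_reg_l (theta q)); [lra|]. rewrite E, Rmult_0_r. apply pow2_ge_0.
  - eapply Rle_trans; [apply Rle_abs|]. unfold theta.
    eapply Rle_trans; [apply Rabs_zsum, zsummable_theta; rewrite Rabs_Ropp; now apply Rabs_unit_interval|].
    apply Req_le, zsum_ext. intros n. rewrite Rabs_powerRZ, Rabs_Ropp, Rabs_pos_eq; lra.
Qed.

Lemma theta_opp_nome_lim q : 0 < q < 1 -> is_lim_seq (fun n => theta (- nome_iter q n)) 1.
Proof.
  intros Hq. eapply is_lim_seq_ext; [|exact (theta_nome_lim q (-1) Hq (or_intror eq_refl))].
  intros n. cbv beta. f_equal. ring.
Qed.

Lemma nome_iter_le q n : 0 < q < 1 -> nome_iter q n <= q.
Proof.
  intros Hq. induction n as [|n IH]; [rewrite nome_iter_0; lra|].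
  rewrite nome_iter_S. pose proof (nome_iter_bounds q n Hq). nra.
Qed.

Lemma theta_opp_step q n : 0 < q < 1 ->
  theta (nome_iter q n) * theta (- nome_iter q n) = theta (- nome_iter q (S n)) ^ 2.
Proof.
  intros Hq. rewrite nome_iter_S. apply theta_mul_theta_opp, Rabs_unit_interval, nome_iter_bounds, Hq.
Qed.

(** Nonnegative by [theta_mul_theta_opp]; and a zero at [q] would propagate to all
    [q^(2^n)], against the limit 1. *)
Lemma theta_opp_pos q : 0 < q < 1 -> 0 < theta (- q).
Proof.
  intros Hq. destruct (theta_opp_bounds q Hq) as [[H|H] _]; [exact H|exfalso].
  assert (Hzero : forall n, theta (- nome_iter q n) = 0).
  { induction n as [|n IH]; [now rewrite nome_iter_0|].
    assert (E := theta_opp_step q n Hq). rewrite IH, Rmult_0_r in E. nra. }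
  assert (L := theta_opp_nome_lim q Hq).
  apply (is_lim_seq_ext _ (fun _ => 0)) in L; [|exact Hzero].
  apply is_lim_seq_unique in L. rewrite Lim_seq_const in L. injection L. lra.
Qed.

(** The numbers [theta (- q^(2^n))] increase (they are geometric means with the
    larger [theta (q^(2^n))]) and tend to 1. *)
Lemma theta_mul_theta_opp_le_1 q : 0 < q < 1 -> theta q * theta (- q) <= 1.
Proof.
  intros Hq.
  assert (Inc : forall n, theta (- nome_iter q n) <= theta (- nome_iter q (S n))).
  { intros n. assert (E := theta_opp_step q n Hq).
    destruct (theta_opp_bounds _ (nome_iter_bounds q n Hq)) as [A B].
    destruct (theta_opp_bounds _ (nome_iter_bounds q (S n) Hq)) as [A' _].
    apply Rsqr_incr_0; [unfold Rsqr; nra | exact A | exact A']. }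
  assert (H := is_lim_seq_incr_compare _ _ (theta_opp_nome_lim q Hq) Inc 1).
  assert (E := theta_opp_step q 0 Hq). rewrite nome_iter_0 in E. rewrite E.
  destruct (theta_opp_bounds _ (nome_iter_bounds q 1 Hq)) as [A' _]. nra.
Qed.

(** The odd part of [theta] is [q * pronic_theta q]. *)
Definition pronic_theta (q : R) : R := zsum (fun i => powerRZ q (4 * i * (i + 1))).

Lemma zsummable_pronic q : 0 < q < 1 -> zsummable (fun i => powerRZ q (4 * i * (i + 1))).
Proof.
  intros Hq. apply zsummable_pow with q 1 1%Z (fun i => (4 * i * (i + 1))%Z); try lra.
  - intros n. rewrite Rabs_powerRZ, Rabs_pos_eq; lra.
  - intros n. nia.
Qed.

Lemma theta_sub_theta_opp q : 0 < q < 1 -> theta q - theta (- q) = 2 * q * pronic_theta q.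
Proof.
  intros Hq. assert (P := theta_parity q (Rabs_unit_interval q Hq)).
  assert (A := theta_add_theta_opp q (Rabs_unit_interval q Hq)).
  assert (E : zsum (fun n => powerRZ q ((2 * n + 1) * (2 * n + 1))) = q * pronic_theta q).
  { unfold pronic_theta. rewrite <- zsum_scal. apply zsum_ext. intros n.
    replace ((2 * n + 1) * (2 * n + 1))%Z with (1 + 4 * n * (n + 1))%Z by lia.
    rewrite powerRZ_add by lra. now rewrite powerRZ_1. }
  rewrite E in P. lra.
Qed.

Lemma pronic_theta_ge_1 q : 0 < q < 1 -> 1 <= pronic_theta q.
Proof.
  intros Hq. unfold pronic_theta, zsum.
  eapply Rle_trans; [|apply (Series_ge_sum _ 0)].
  - rewrite sum_n_0. unfold zpair. simpl. lra.
  - intros n. unfold zpair. apply Rplus_le_le_0_compat; apply powerRZ_le; lra.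
  - apply zsummable_ex, zsummable_pronic, Hq.
Qed.

Lemma theta_mono x q : 0 < x <= q -> q < 1 -> theta x <= theta q.
Proof.
  intros Hx Hq. apply zsum_le; [|apply zsummable_theta, Rabs_unit_interval; lra].
  intros n. split; [apply powerRZ_le; lra|].
  rewrite <- (Z2Nat.id (n * n)) by nia. rewrite <- !pow_powerRZ. apply pow_incr. lra.
Qed.

Lemma pronic_theta_mono x q : 0 < x <= q -> q < 1 -> pronic_theta x <= pronic_theta q.
Proof.
  intros Hx Hq. apply zsum_le; [|apply zsummable_pronic; lra].
  intros n. split; [apply powerRZ_le; lra|].
  rewrite <- (Z2Nat.id (4 * n * (n + 1))) by nia. rewrite <- !pow_powerRZ. apply pow_incr. lra.
Qed.

(** * Theta near 1, and continuity *)

Lemma bernoulli_sub h n : 0 <= h <= 1 -> 1 - INR n * h <= (1 - h) ^ n.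
Proof.
  intros Hh. induction n as [|n IH].
  - simpl. lra.
  - rewrite S_INR. simpl. pose proof (pos_INR n).
    apply Rle_trans with ((1 - h) * (1 - INR n * h)); [nra|].
    apply Rmult_le_compat_l; lra.
Qed.

(** With [k = (M + 1)^2] and [q = 1 - 1 / (2 k)], Bernoulli's inequality makes each
    of the [2 (M + 1)] terms with [n^2 <= k] at least 1/2. *)
Lemma theta_unbounded (M : nat) : exists q, 0 < q < 1 /\ INR M <= theta q.
Proof.
  set (k := (S M * S M)%nat).
  assert (Hk : 1 <= INR k) by (rewrite <- INR_1; apply le_INR; unfold k; nia).
  set (h := / (2 * INR k)).
  assert (Hkh : INR k * h = 1 / 2) by (unfold h; field; lra).
  assert (Hh : 0 < h <= 1 / 2) by (split; [apply Rinv_0_lt_compat|]; nra).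
  exists (1 - h). split; [lra|].
  assert (Hterm : forall n, (n * n <= Z.of_nat k)%Z -> 1 / 2 <= powerRZ (1 - h) (n * n)).
  { intros n Hn. apply Rle_trans with (powerRZ (1 - h) (Z.of_nat k)).
    - rewrite <- pow_powerRZ. pose proof (bernoulli_sub h k). lra.
    - apply powerRZ_decr; [lra|exact Hn]. }
  apply Rle_trans with (sum_n (zpair (fun n => powerRZ (1 - h) (n * n))) M).
  - assert (H : forall N, (N <= M)%nat ->
      INR (S N) <= sum_n (zpair (fun n => powerRZ (1 - h) (n * n))) N).
    { induction N as [|N IH]; intros HN.
      - rewrite sum_n_0. unfold zpair. simpl INR.
        pose proof (Hterm (Z.of_nat 0) ltac:(unfold k; nia)).
        pose proof (Hterm (-1 - Z.of_nat 0)%Z ltac:(unfold k; nia)). lra.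
      - rewrite sum_n_S, S_INR. specialize (IH ltac:(lia)). unfold zpair at 2.
        pose proof (Hterm (Z.of_nat (S N)) ltac:(unfold k; nia)).
        pose proof (Hterm (-1 - Z.of_nat (S N))%Z ltac:(unfold k; nia)). lra. }
    eapply Rle_trans; [|apply H; lia]. rewrite S_INR. lra.
  - apply Series_ge_sum.
    + intros n. unfold zpair. apply Rplus_le_le_0_compat; apply powerRZ_le; lra.
    + apply zsummable_ex, zsummable_theta, Rabs_unit_interval. lra.
Qed.

Lemma theta_continuous s x : s = 1 \/ s = -1 -> 0 < x < 1 ->
  continuity_pt (fun x => theta (s * x)) x.
Proof.
  intros Hs Hx. apply continuity_pt_filterlim.
  assert (Hnear : locally x (fun y => 0 < y < (1 + x) / 2)).
  { assert (D : 0 < Rmin x ((1 - x) / 2)) by (apply Rmin_pos; lra).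
    exists (mkposreal _ D). intros y Hy.
    unfold ball in Hy; simpl in Hy; unfold AbsRing_ball in Hy; simpl in Hy.
    unfold abs, minus, plus, opp in Hy; simpl in Hy.
    pose proof (Rmin_l x ((1 - x) / 2)). pose proof (Rmin_r x ((1 - x) / 2)).
    apply Rabs_def2 in Hy. lra. }
  assert (Hb : forall y n, 0 < y < (1 + x) / 2 ->
    Rabs (powerRZ (s * y) (n * n)) <= powerRZ ((1 + x) / 2) (n * n)).
  { intros y n Hy. rewrite Rabs_powerRZ, Rabs_mult.
    replace (Rabs s) with 1 by (destruct Hs as [-> | ->]; rewrite ?(Rabs_left (-1)), ?Rabs_R1; lra).
    rewrite Rmult_1_l, Rabs_pos_eq by lra.
    rewrite <- (Z2Nat.id (n * n)) by nia. rewrite <- !pow_powerRZ. apply pow_incr. lra. }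
  apply (zsum_tannery (locally x) (fun y n => powerRZ (s * y) (n * n))
     (fun n => powerRZ (s * x) (n * n)) (fun n => powerRZ ((1 + x) / 2) (n * n))).
  - apply zsummable_theta, Rabs_unit_interval. lra.
  - revert Hnear. apply filter_imp. intros y Hy n. now apply Hb.
  - intros n. apply Hb. lra.
  - intros n.
    apply filterlim_ext with (fun y => (s * y) ^ Z.to_nat (n * n)).
    + intros y. rewrite pow_powerRZ, Z2Nat.id by nia. reflexivity.
    + replace (powerRZ (s * x) (n * n)) with ((s * x) ^ Z.to_nat (n * n))
        by (rewrite pow_powerRZ, Z2Nat.id by nia; reflexivity).
      apply (ex_derive_continuous (fun y => (s * y) ^ Z.to_nat (n * n)) x).
      auto_derive. exact I.
Qed.

(** * The Lambert series with alternating pairs of signs *)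

Lemma zsum_fold f : zsummable f ->
  zsum f = f 0%Z + Series (fun n => f (Z.of_nat (S n)) + f (- Z.of_nat (S n))%Z).
Proof.
  intros H. rewrite zsum_halves_eq by exact H. destruct (zsum_halves f H) as [H1 H2].
  apply ex_series_Rabs in H1. apply ex_series_Rabs in H2.
  rewrite Series_incr_1 by exact H1. apply ex_series_incr_1 in H1.
  rewrite Series_plus, Rplus_assoc.
  - do 2 f_equal. apply Series_ext. intros n. f_equal. lia.
  - exact H1.
  - eapply ex_series_ext; [|exact H2]. intros n; cbv beta. f_equal. lia.
Qed.

Lemma lambert_sum_fold q : 0 < q < 1 ->
  2 * lambert_sum q = 1 + 2 * Series (fun j => (q ^ S j + (q ^ S j) ^ 3) / (1 + (q ^ S j) ^ 4)).
Proof.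
  intros Hq. unfold lambert_sum. rewrite zsum_fold by apply zsummable_lambert_sum, Rabs_unit_interval, Hq.
  rewrite (Series_ext (fun n => powerRZ q (Z.of_nat (S n)) / _ + _)
    (fun j => (q ^ S j + (q ^ S j) ^ 3) / (1 + (q ^ S j) ^ 4))).
  - simpl powerRZ. field.
  - intros n. rewrite !(Z.mul_comm 4), <- !(pow_powerRZ).
    assert (P : 0 < q ^ S n) by (apply pow_lt; lra).
    assert (E : forall z, powerRZ q (z * 4) = powerRZ q z ^ 4).
    { intros z. rewrite pow_powerRZ. change (Z.of_nat 4) with 4%Z.
      replace (z * 4)%Z with (z + z + z + z)%Z by lia. rewrite !powerRZ_add by lra. simpl. ring. }
    rewrite !E, powerRZ_neg', <- pow_powerRZ. set (x := q ^ S n) in *. clearbody x.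
    assert (0 < x ^ 4) by (apply pow_lt; lra).
    field; repeat split; simpl in *; lra.
Qed.

Lemma alternating_pairs_geom x : 0 < x < 1 ->
  is_series (fun n => (-1) ^ (n / 2) * x ^ (2 * n + 1)) ((x + x ^ 3) / (1 + x ^ 4)).
Proof.
  intros Hx.
  assert (Hx2 : 0 < x ^ 2 < 1) by nra.
  assert (Hx4 : 0 < x ^ 4 < 1) by (replace (x ^ 4) with (x ^ 2 * x ^ 2) by ring; nra).
  assert (Habs : ex_series (fun n => Rabs ((-1) ^ (n / 2) * x ^ (2 * n + 1)))).
  { apply ex_series_dominated with (fun n => (x ^ 2) ^ n).
    - intros n. rewrite Rabs_Rabsolu, Rabs_mult, pow_1_abs, Rmult_1_l.
      rewrite Rabs_pos_eq by (apply pow_le; lra). rewrite <- pow_mult, pow_add.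
      rewrite <- (Rmult_1_r (x ^ (2 * n))) at 2. apply Rmult_le_compat_l; [apply pow_le; lra|lra].
    - apply ex_series_geom. rewrite Rabs_pos_eq; lra. }
  destruct (Series_split_parity _ Habs) as (_ & _ & E).
  assert (G : forall c, Series (fun t => c * (- x ^ 4) ^ t) = c / (1 + x ^ 4)).
  { intros c. rewrite Series_scal_l, Series_geom by (rewrite Rabs_Ropp, Rabs_pos_eq; lra).
    unfold Rdiv. do 2 f_equal. ring. }
  replace ((x + x ^ 3) / (1 + x ^ 4)) with (Series (fun n => (-1) ^ (n / 2) * x ^ (2 * n + 1))).
  { apply Series_correct, ex_series_Rabs, Habs. }
  rewrite E. rewrite (Series_ext _ (fun t => x * (- x ^ 4) ^ t)).
  - rewrite (Series_ext (fun n => (-1) ^ ((2 * n + 1) / 2) * _) (fun t => x ^ 3 * (- x ^ 4) ^ t)).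
    + rewrite !G. field. lra.
    + intros n. replace ((2 * n + 1) / 2)%nat with n.
      * replace (2 * (2 * n + 1) + 1)%nat with (3 + 4 * n)%nat by lia.
        replace (- x ^ 4) with (-1 * x ^ 4) by ring.
        rewrite Rpow_mult_distr, pow_add, pow_mult. ring.
      * rewrite Nat.mul_comm, Nat.div_add_l by lia. simpl. lia.
  - intros n. replace (2 * n / 2)%nat with n.
    * replace (2 * (2 * n) + 1)%nat with (1 + 4 * n)%nat by lia.
      replace (- x ^ 4) with (-1 * x ^ 4) by ring.
      rewrite Rpow_mult_distr, pow_add, pow_mult. ring.
    * rewrite Nat.mul_comm, Nat.div_mul by lia. reflexivity.
Qed.

(** Expanding [q^m / (1 - q^m) = sum_j (q^j)^m] and summing over [m] first. The
    partial sums over [m] are dominated by the geometric series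
    [q^j / (1 - q^2)], whatever the signs. *)
Lemma is_series_lambert q : 0 < q < 1 ->
  is_series (fun n => (-1) ^ (n / 2) * (q ^ (2 * n + 1) / (1 - q ^ (2 * n + 1))))
    (lambert_sum q - 1 / 2).
Proof.
  intros Hq.
  replace (lambert_sum q - 1 / 2) with (Series (fun j => (q ^ S j + (q ^ S j) ^ 3) / (1 + (q ^ S j) ^ 4)))
    by (pose proof (lambert_sum_fold q Hq); lra).
  assert (Hx : forall j, 0 < q ^ S j <= q).
  { intros j. split; [apply pow_lt; lra|]. simpl. rewrite <- (Rmult_1_r q) at 3.
    apply Rmult_le_compat_l; [lra|]. rewrite <- (pow1 j). apply pow_incr. lra. }
  assert (Hq2 : 0 < q ^ 2 < 1) by nra.
  set (part := fun M j => sum_n (fun n => (-1) ^ (n / 2) * (q ^ S j) ^ (2 * n + 1)) M).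
  assert (Hpart : forall M, ex_series (part M) /\
    sum_n (fun n => (-1) ^ (n / 2) * (q ^ (2 * n + 1) / (1 - q ^ (2 * n + 1)))) M
    = Series (part M) :> R).
  { assert (G : forall n, is_series (fun j => (-1) ^ (n / 2) * (q ^ S j) ^ (2 * n + 1))
        ((-1) ^ (n / 2) * (q ^ (2 * n + 1) / (1 - q ^ (2 * n + 1))))).
    { intros n. apply (is_series_scal_l (V := R_NormedModule) ((-1) ^ (n / 2))).
      assert (Hy : 0 <= q ^ (2 * n + 1) < 1).
      { split; [apply pow_le; lra | apply pow_lt_1_compat; [lra|lia]]. }
      set (y := q ^ (2 * n + 1)) in *.
      apply is_series_ext with (fun j => scal y (y ^ j)).
      - intros j. unfold y, scal; simpl; unfold mult; simpl.
        rewrite (Rmult_comm q), Rpow_mult_distr, <- !pow_mult.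
        rewrite (Nat.mul_comm j). simpl. ring.
      - unfold Rdiv. apply (is_series_scal_l (V := R_NormedModule) y). apply is_series_geom.
        rewrite Rabs_pos_eq; lra. }
    intros M. induction M as [|M [IH1 IH2]].
    - rewrite sum_n_0. split.
      + eexists. eapply is_series_ext; [|exact (G 0%nat)]. intros j. unfold part. now rewrite sum_n_0.
      + rewrite <- (is_series_unique _ _ (G 0%nat)). apply Series_ext. intros j.
        unfold part. now rewrite sum_n_0.
    - rewrite sum_n_S. assert (G' := G (S M)).
      assert (X : forall j, part M j + (-1) ^ (S M / 2) * (q ^ S j) ^ (2 * S M + 1) = part (S M) j)
        by (intros j; unfold part; now rewrite sum_n_S).
      split.
      + eapply ex_series_ext; [exact X|]. apply (ex_series_plus (part M)); [exact IH1|].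
        eexists; exact G'.
      + rewrite IH2, <- (is_series_unique _ _ G'), <- Series_plus.
        * apply Series_ext, X.
        * exact IH1.
        * eexists; exact G'. }
  unfold is_series. apply filterlim_ext with (fun M => Series (part M)).
  { intros M. symmetry. apply Hpart. }
  apply (Series_tannery eventually part
     (fun j => (q ^ S j + (q ^ S j) ^ 3) / (1 + (q ^ S j) ^ 4))
     (fun j => / (1 - q ^ 2) * q ^ S j)).
  - apply (ex_series_scal_l (V := R_NormedModule) (/ (1 - q ^ 2))). apply (ex_series_incr_1 (fun j => q ^ j)).
    apply ex_series_geom. rewrite Rabs_pos_eq; lra.
  - apply filter_forall. intros M j. specialize (Hx j). set (x := q ^ S j) in *.
    assert (B : forall N, Rabs (part N j) <= x * ((1 - (x ^ 2) ^ S N) / (1 - x ^ 2))).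
    { intros N. assert (x ^ 2 < 1) by nra. unfold part. fold x. induction N as [|N IH].
      - rewrite sum_n_0. simpl Nat.div. rewrite Rabs_pos_eq by (simpl; lra).
        apply Req_le. simpl. field. simpl in *. lra.
      - rewrite sum_n_S. eapply Rle_trans; [apply Rabs_triang|].
        eapply Rle_trans; [apply Rplus_le_compat_r, IH|].
        rewrite Rabs_mult, pow_1_abs, Rmult_1_l, Rabs_pos_eq by (apply pow_le; lra).
        rewrite pow_add, pow_mult, pow_1. apply Req_le.
        replace ((x ^ 2) ^ S (S N)) with (x ^ 2 * (x ^ 2) ^ S N) by reflexivity.
        field. lra. }
    eapply Rle_trans; [apply B|]. rewrite (Rmult_comm (/ _)). apply Rmult_le_compat_l; [lra|].
    assert (x ^ 2 <= q ^ 2) by nra. assert (0 <= (x ^ 2) ^ S M) by (apply pow_le; nra).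
    rewrite <- (Rmult_1_l (/ (1 - q ^ 2))). apply Rmult_le_compat; try lra.
    + assert ((x ^ 2) ^ S M <= 1); [|lra]. rewrite <- (pow1 (S M)). apply pow_incr. nra.
    + left; apply Rinv_0_lt_compat. lra.
    + apply Rinv_le_contravar; lra.
  - intros j. specialize (Hx j). set (x := q ^ S j) in *. clearbody x.
    assert (0 < x ^ 2 <= q ^ 2) by nra. assert (0 < x ^ 3) by (apply pow_lt; lra).
    assert (0 < x ^ 4) by (apply pow_lt; lra).
    rewrite Rabs_pos_eq by (apply Rle_div_r; lra).
    apply Rle_div_l; [lra|]. apply (Rmult_le_reg_r (1 - q ^ 2)); [lra|].
    replace (/ (1 - q ^ 2) * x * (1 + x ^ 4) * (1 - q ^ 2)) with (x * (1 + x ^ 4)) by (field; lra).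
    replace ((x + x ^ 3) * (1 - q ^ 2)) with (x * ((1 + x ^ 2) * (1 - q ^ 2))) by ring.
    apply Rmult_le_compat_l; [lra|]. replace (x ^ 4) with (x ^ 2 * x ^ 2) by ring. nra.
  - intros j. apply alternating_pairs_geom. specialize (Hx j). lra.
Qed.

(** * Gauss's integral and its Landen transformation *)

Definition gauss_form (a b t : R) : R := a ^ 2 * cos t ^ 2 + b ^ 2 * sin t ^ 2.

(** Equal to [PI / 2] divided by the arithmetic-geometric mean of [a] and [b]. *)
Definition gauss_int (a b : R) : R := RInt (fun t => / sqrt (gauss_form a b t)) 0 (PI / 2).

Lemma cos2_sin2 t : cos t ^ 2 = 1 - sin t ^ 2.
Proof. pose proof (sin2_cos2 t) as H. unfold Rsqr in H. simpl. lra. Qed.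

Lemma sin_sqr_bounds t : 0 <= sin t ^ 2 <= 1.
Proof.
  split; [apply pow2_ge_0|]. pose proof (pow2_ge_0 (cos t)) as H. rewrite cos2_sin2 in H. lra.
Qed.

Lemma convex_comb_pos A B s : 0 < A -> 0 < B -> 0 <= s <= 1 -> 0 < A * (1 - s) + B * s.
Proof. intros HA HB Hs. destruct (Rlt_le_dec s 1); nra. Qed.

Lemma gauss_form_pos a b t : 0 < a -> 0 < b -> 0 < gauss_form a b t.
Proof.
  intros Ha Hb. unfold gauss_form. rewrite cos2_sin2.
  apply convex_comb_pos; [apply pow_lt; lra | apply pow_lt; lra | apply sin_sqr_bounds].
Qed.

Lemma continuous_gauss a b t : 0 < a -> 0 < b -> continuous (fun t => / sqrt (gauss_form a b t)) t.
Proof.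
  intros Ha Hb. apply (ex_derive_continuous (fun t => / sqrt (gauss_form a b t))).
  assert (P := gauss_form_pos a b t Ha Hb). assert (0 < sqrt (gauss_form a b t)) by now apply sqrt_lt_R0.
  unfold gauss_form in *. auto_derive. simpl in *. rewrite !Rmult_1_r in *. repeat split; lra.
Qed.

Lemma ex_RInt_gauss a b u v : 0 < a -> 0 < b -> ex_RInt (fun t => / sqrt (gauss_form a b t)) u v.
Proof.
  intros Ha Hb. apply (ex_RInt_continuous (V := R_CompleteNormedModule)).
  intros z _. now apply continuous_gauss.
Qed.

Lemma RInt_Rmult_l (f : R -> R) k u v : ex_RInt f u v ->
  RInt (fun t => k * f t) u v = k * RInt f u v.
Proof. exact (RInt_scal f u v k). Qed.

Lemma RInt_reflect (f : R -> R) v u : (forall x y, ex_RInt f x y) ->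
  RInt (fun t => f (v - t)) 0 u = RInt f (v - u) v.
Proof.
  intros Hf.
  assert (E := RInt_comp_lin f (-1) v 0 u (Hf _ _)).
  replace (-1 * 0 + v) with v in E by ring. replace (-1 * u + v) with (v - u) in E by ring.
  rewrite <- (opp_RInt_swap f) in E by apply Hf.
  rewrite (RInt_scal (fun y => f (-1 * y + v))) in E.
  - rewrite (RInt_ext _ (fun y => f (-1 * y + v))) by (intros x _; f_equal; ring).
    unfold scal, opp in E; simpl in E; unfold mult in E; simpl in E. lra.
  - assert (X := ex_RInt_comp_lin f (-1) v 0 u (Hf _ _)).
    apply (ex_RInt_scal _ _ _ (-1)) in X. eapply ex_RInt_ext; [|exact X].
    intros x _. unfold scal; simpl; unfold mult; simpl. ring.
Qed.

Lemma gauss_int_sym a b : 0 < a -> 0 < b -> gauss_int a b = gauss_int b a.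
Proof.
  intros Ha Hb. unfold gauss_int.
  replace 0 with (PI / 2 - PI / 2) at 2 by ring.
  rewrite <- (RInt_reflect _ (PI / 2) (PI / 2)) by (intros; now apply ex_RInt_gauss).
  apply RInt_ext. intros t _. unfold gauss_form.
  rewrite cos_shift, sin_shift. do 2 f_equal. ring.
Qed.

Lemma gauss_int_scal s a b : 0 < s -> 0 < a -> 0 < b ->
  gauss_int (s * a) (s * b) = gauss_int a b / s.
Proof.
  intros Hs Ha Hb. replace (gauss_int a b / s) with (/ s * gauss_int a b) by apply Rmult_comm.
  unfold gauss_int.
  rewrite <- RInt_Rmult_l by now apply ex_RInt_gauss.
  apply RInt_ext. intros t _.
  replace (gauss_form (s * a) (s * b) t) with (s ^ 2 * gauss_form a b t) by (unfold gauss_form; ring).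
  assert (P := gauss_form_pos a b t Ha Hb).
  rewrite sqrt_mult, sqrt_pow2 by (try apply pow2_ge_0; lra).
  rewrite Rinv_mult. reflexivity.
Qed.

Lemma gauss_int_bounds a b : 0 < b <= a ->
  PI / 2 / a <= gauss_int a b <= PI / 2 / b.
Proof.
  intros Hab.
  assert (C : forall c, RInt (fun _ => / c) 0 (PI / 2) = PI / 2 / c).
  { intros c. rewrite RInt_const. unfold scal; simpl; unfold mult; simpl. unfold Rdiv. ring. }
  assert (PP := PI_RGT_0).
  assert (Hf : forall t, b <= sqrt (gauss_form a b t) <= a).
  { intros t. assert (S := sin_sqr_bounds t).
    assert (b ^ 2 <= a ^ 2) by (apply pow_incr; lra).
    assert (G : b ^ 2 <= gauss_form a b t <= a ^ 2) by (unfold gauss_form; rewrite cos2_sin2; nra).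
    split.
    - rewrite <- (sqrt_pow2 b) at 1 by lra. apply sqrt_le_1_alt; lra.
    - apply Rle_trans with (sqrt (a ^ 2)); [apply sqrt_le_1_alt; lra|].
      rewrite sqrt_pow2; lra. }
  unfold gauss_int. rewrite <- !C. assert (X : ex_RInt (fun t => / sqrt (gauss_form a b t)) 0 (PI / 2))
    by (apply ex_RInt_gauss; lra).
  split; (apply RInt_le; [lra | exact X || apply ex_RInt_const | exact X || apply ex_RInt_const |
    intros t _; apply Rinv_le_contravar; specialize (Hf t); lra]).
Qed.

Definition landen_num (a b t : R) : R := (a - b) * (sin t * cos t).
Definition landen_den (a b t : R) : R := a * cos t ^ 2 + b * sin t ^ 2.

(** Landen's substitution is [t + psi] with [tan psi = (b / a) tan t]. Writing it
    as [2 t - (t - psi)] and expanding the tangent of [t - psi] gives a formula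
    that is smooth at [PI / 2] as well. *)
Definition landen_ang (a b t : R) : R := 2 * t - atan (landen_num a b t / landen_den a b t).

Lemma landen_den_pos a b t : 0 < a -> 0 < b -> 0 < landen_den a b t.
Proof.
  intros Ha Hb.
  unfold landen_den. rewrite cos2_sin2.
  apply convex_comb_pos; [lra | lra | apply sin_sqr_bounds].
Qed.

Lemma landen_num2_den2 a b t : landen_num a b t ^ 2 + landen_den a b t ^ 2 = gauss_form a b t.
Proof.
  unfold landen_num, landen_den, gauss_form.
  transitivity ((a ^ 2 * cos t ^ 2 + b ^ 2 * sin t ^ 2) * (sin t ^ 2 + cos t ^ 2)); [ring|].
  rewrite (cos2_sin2 t). ring.
Qed.

Lemma cos_sin_landen_ang a b t : 0 < a -> 0 < b ->
  cos (landen_ang a b t) = (a * cos t ^ 2 - b * sin t ^ 2) / sqrt (gauss_form a b t) /\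
  sin (landen_ang a b t) = (a + b) * (sin t * cos t) / sqrt (gauss_form a b t).
Proof.
  intros Ha Hb.
  assert (D := landen_den_pos a b t Ha Hb). assert (P := gauss_form_pos a b t Ha Hb).
  assert (Q : 0 < sqrt (gauss_form a b t)) by now apply sqrt_lt_R0.
  assert (E : sqrt (1 + (landen_num a b t / landen_den a b t)²) = sqrt (gauss_form a b t) / landen_den a b t).
  { rewrite <- (sqrt_pow2 (sqrt (gauss_form a b t) / landen_den a b t))
      by (apply Rlt_le, Rdiv_lt_0_compat; lra).
    f_equal. unfold Rdiv at 2. rewrite Rpow_mult_distr, pow2_sqrt, <- landen_num2_den2 by lra.
    unfold Rsqr. field. lra. }
  assert (Cd : cos (atan (landen_num a b t / landen_den a b t)) = landen_den a b t / sqrt (gauss_form a b t)).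
  { rewrite cos_atan, E. field. lra. }
  assert (Sd : sin (atan (landen_num a b t / landen_den a b t)) = landen_num a b t / sqrt (gauss_form a b t)).
  { rewrite sin_atan, E. field. lra. }
  unfold landen_ang. rewrite cos_minus, sin_minus, Cd, Sd, cos_2a, sin_2a.
  assert (T : forall x y, x / sqrt (gauss_form a b t) = y / sqrt (gauss_form a b t) <-> x = y).
  { intros x y; split; [|now intros ->]. intros H. apply Rmult_eq_reg_r in H; [exact H|].
    apply Rinv_neq_0_compat. lra. }
  assert (C2 := cos2_sin2 t).
  split.
  - transitivity (((cos t * cos t - sin t * sin t) * landen_den a b t + 2 * sin t * cos t * landen_num a b t)
      / sqrt (gauss_form a b t)).
    + field. lra.
    + apply T. unfold landen_den, landen_num.
      transitivity ((a * cos t ^ 2 - b * sin t ^ 2) * (sin t ^ 2 + cos t ^ 2)); [ring|].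
      rewrite C2. ring.
  - transitivity ((2 * sin t * cos t * landen_den a b t - (cos t * cos t - sin t * sin t) * landen_num a b t)
      / sqrt (gauss_form a b t)).
    + field. lra.
    + apply T. unfold landen_den, landen_num.
      transitivity ((a + b) * (sin t * cos t) * (sin t ^ 2 + cos t ^ 2)); [ring|].
      rewrite C2. ring.
Qed.

Lemma is_derive_landen_ang a b t : 0 < a -> 0 < b ->
  is_derive (landen_ang a b) t (1 + a * b / gauss_form a b t).
Proof.
  intros Ha Hb.
  assert (D := landen_den_pos a b t Ha Hb). assert (P := gauss_form_pos a b t Ha Hb).
  assert (N := landen_num2_den2 a b t).
  assert (Dn : is_derive (landen_num a b) t ((a - b) * (cos t ^ 2 - sin t ^ 2))).
  { unfold landen_num. auto_derive; [trivial | ring]. }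
  assert (Dd : is_derive (landen_den a b) t (2 * (b - a) * (sin t * cos t))).
  { unfold landen_den. auto_derive; [trivial | ring]. }
  assert (Dt := is_derive_comp atan (fun t => landen_num a b t / landen_den a b t) t _ _ (is_derive_atan _)
    (is_derive_div (landen_num a b) (landen_den a b) t _ _ Dn Dd (Rgt_not_eq _ _ D))).
  assert (D2 := is_derive_scal (fun t => t) t 2 _ (is_derive_id t)).
  assert (X := is_derive_minus _ _ t _ _ D2 Dt).
  unfold minus, plus, opp, scal, one in X; simpl in X; unfold mult in X; simpl in X.
  replace (1 + a * b / gauss_form a b t) with
    (2 * 1 + - (((a - b) * (cos t * (cos t * 1) - sin t * (sin t * 1)) * landen_den a b t -
       landen_num a b t * (2 * (b - a) * (sin t * cos t))) / (landen_den a b t * (landen_den a b t * 1)) *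
       / (1 + (landen_num a b t / landen_den a b t)²))); [exact X|].
  replace (1 + (landen_num a b t / landen_den a b t)²) with (gauss_form a b t / landen_den a b t ^ 2)
    by (rewrite <- N; unfold Rsqr; field; lra).
  replace (a * b) with (gauss_form a b t - ((a - b) * (cos t ^ 2 - sin t ^ 2) * landen_den a b t -
       landen_num a b t * (2 * (b - a) * (sin t * cos t)))).
  - field. lra.
  - unfold gauss_form, landen_num, landen_den.
    transitivity (a ^ 2 * cos t ^ 2 + b ^ 2 * sin t ^ 2
      - (a - b) * (a * cos t ^ 2 - b * sin t ^ 2) * (sin t ^ 2 + cos t ^ 2)); [ring|].
    rewrite (cos2_sin2 t). ring.
Qed.

(** Gauss's invariance under an AGM step: with [s] for [landen_ang a b t], the
    derivative of [s] is [2 a1 den / form] and the square root of the new form at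
    [s] is [a1 den / sqrt form], where [a1 = (a + b) / 2], so the integrand becomes
    twice the old one. As [t] runs over a quarter period [s] runs over a half
    period, which accounts for the 2. *)
Lemma gauss_int_landen a b : 0 < a -> 0 < b ->
  gauss_int ((a + b) / 2) (sqrt (a * b)) = gauss_int a b.
Proof.
  intros Ha Hb.
  set (a1 := (a + b) / 2). set (b1 := sqrt (a * b)).
  assert (Ha1 : 0 < a1) by (unfold a1; lra).
  assert (Hb1 : 0 < b1) by (unfold b1; apply sqrt_lt_R0; nra).
  set (f := fun t => / sqrt (gauss_form a1 b1 t)).
  assert (A0 : landen_ang a b 0 = 0).
  { unfold landen_ang. replace (landen_num a b 0 / landen_den a b 0) with 0
      by (unfold landen_num, Rdiv; rewrite sin_0; ring).
    rewrite atan_0. ring. }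
  assert (A1 : landen_ang a b (PI / 2) = PI).
  { unfold landen_ang. replace (landen_num a b (PI / 2) / landen_den a b (PI / 2)) with 0
      by (unfold landen_num; rewrite cos_PI2; unfold Rdiv; ring).
    rewrite atan_0. field. }
  assert (Xf : forall u v, ex_RInt f u v) by (intros; now apply ex_RInt_gauss).
  assert (R2 : RInt f 0 PI = 2 * gauss_int a1 b1).
  { rewrite <- (RInt_Chasles f 0 (PI / 2) PI) by apply Xf.
    replace (RInt f (PI / 2) PI) with (RInt f 0 (PI / 2)).
    - unfold plus; simpl. unfold gauss_int. fold f. ring.
    - replace (PI / 2) with (PI - PI / 2) at 2 by lra.
      rewrite <- (RInt_reflect f PI (PI / 2)) by exact Xf.
      apply RInt_ext. intros t _. unfold f, gauss_form.
      rewrite sin_PI_x. replace (cos (PI - t)) with (- cos t).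
      + do 2 f_equal. ring.
      + rewrite cos_minus, cos_PI, sin_PI. ring. }
  assert (E := RInt_comp f (landen_ang a b) (fun t => 1 + a * b / gauss_form a b t) 0 (PI / 2)).
  rewrite A0, A1, R2 in E.
  assert (E' : RInt (fun t => 2 * / sqrt (gauss_form a b t)) 0 (PI / 2) = 2 * gauss_int a1 b1).
  { rewrite <- E.
    - apply RInt_ext. intros t _. unfold scal; simpl; unfold mult; simpl.
      assert (P := gauss_form_pos a b t Ha Hb).
      assert (Q : 0 < sqrt (gauss_form a b t)) by now apply sqrt_lt_R0.
      assert (D := landen_den_pos a b t Ha Hb).
      unfold f. destruct (cos_sin_landen_ang a b t Ha Hb) as [Ec Es].
      set (r := sqrt (gauss_form a b t)) in *.
      assert (Hr : r ^ 2 = gauss_form a b t) by (apply pow2_sqrt; lra).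
      replace (gauss_form a1 b1 (landen_ang a b t)) with ((a1 * landen_den a b t / r) ^ 2).
      + rewrite sqrt_pow2 by (apply Rlt_le, Rdiv_lt_0_compat; nra).
        rewrite <- Hr. transitivity ((r ^ 2 + a * b) / (a1 * landen_den a b t) / r); [|field; lra].
        replace (r ^ 2 + a * b) with (2 * (a1 * landen_den a b t)); [field; split; [lra|nra]|].
        rewrite Hr. unfold a1, landen_den, gauss_form.
        transitivity (a ^ 2 * cos t ^ 2 + b ^ 2 * sin t ^ 2 + a * b * (sin t ^ 2 + cos t ^ 2)).
        * field.
        * rewrite (cos2_sin2 t). ring.
      + unfold gauss_form at 1. rewrite Ec, Es. unfold b1. rewrite pow2_sqrt by nra.
        unfold a1, landen_den. field. lra.
    - intros t _. now apply continuous_gauss.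
    - intros t _. split; [now apply is_derive_landen_ang|].
      apply (ex_derive_continuous (fun t => 1 + a * b / gauss_form a b t)).
      assert (P := gauss_form_pos a b t Ha Hb). unfold gauss_form in *.
      auto_derive. simpl in *. rewrite !Rmult_1_r in *. lra. }
  rewrite RInt_Rmult_l in E' by now apply ex_RInt_gauss.
  fold (gauss_int a b) in E'. lra.
Qed.

(** The logarithmic singularity of the complementary integral. After swapping sine
    and cosine the form is [c^2 + e^2 sin^2]. Inserting a factor [cos t] makes the
    integrand elementary, with primitive [ln (e sin t + sqrt form) / e], and costs
    at most [(1 - cos t) / (e sin t) <= 1 / e]. *)
Lemma gauss_int_log_bounds a c e : 0 < c -> 0 < e -> 0 < a -> a ^ 2 = c ^ 2 + e ^ 2 ->
  (ln (e + a) - ln c) / e <= gauss_int a c <= (ln (e + a) - ln c) / e + PI / 2 / e.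
Proof.
  intros Hc He Ha Hace.
  assert (PP := PI_RGT_0).
  set (g := fun t => c ^ 2 + e ^ 2 * sin t ^ 2).
  assert (Hg : forall t, 0 < g t).
  { intros t. unfold g. pose proof (pow2_ge_0 (sin t)). assert (0 < c ^ 2) by (apply pow_lt; lra).
    assert (0 < e ^ 2) by (apply pow_lt; lra). nra. }
  assert (Hs : forall t, 0 < sqrt (g t)) by (intros; now apply sqrt_lt_R0).
  assert (Hes : forall t, e * Rabs (sin t) < sqrt (g t)).
  { intros t. apply Rsqr_incrst_0.
    - rewrite Rsqr_sqrt by (apply Rlt_le, Hg). rewrite Rsqr_mult, <- Rsqr_abs. unfold Rsqr, g.
      assert (0 < c ^ 2) by (apply pow_lt; lra). simpl in *. lra.
    - pose proof (Rabs_pos (sin t)). nra.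
    - apply Rlt_le, Hs. }
  assert (Harg : forall t, 0 < e * sin t + sqrt (g t)).
  { intros t. specialize (Hes t). pose proof (Rabs_left1 (sin t)).
    unfold Rabs in Hes. destruct (Rcase_abs (sin t)); specialize (Hs t); nra. }
  assert (I : is_RInt (fun t => cos t / sqrt (g t)) 0 (PI / 2) ((ln (e + a) - ln c) / e)).
  { replace ((ln (e + a) - ln c) / e) with
      (minus (/ e * ln (e * sin (PI / 2) + sqrt (g (PI / 2)))) (/ e * ln (e * sin 0 + sqrt (g 0)))).
    - apply (is_RInt_derive (fun t => / e * ln (e * sin t + sqrt (g t)))).
      + intros t _. assert (H1 := Hg t). assert (H2 := Hs t). assert (H3 := Harg t).
        unfold g in *. auto_derive.
        * simpl in *. rewrite !Rmult_1_r in *. auto.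
        * simpl in *. rewrite !Rmult_1_r in *. field. repeat split; lra.
      + intros t _. apply (ex_derive_continuous (fun t => cos t / sqrt (g t))).
        assert (H1 := Hg t). assert (H2 := Hs t). unfold g in *. auto_derive.
        simpl in *. rewrite !Rmult_1_r in *. repeat split; lra.
    - unfold g. rewrite sin_PI2, sin_0. unfold minus, plus, opp; simpl.
      replace (c * (c * 1) + e * (e * 1) * (1 * (1 * 1))) with (a ^ 2) by lra.
      replace (c * (c * 1) + e * (e * 1) * (0 * (0 * 1))) with (c ^ 2) by ring.
      rewrite !sqrt_pow2 by lra. rewrite Rmult_0_r, Rplus_0_l, Rmult_1_r. field. lra. }
  assert (Isum : is_RInt (fun t => cos t / sqrt (g t) + / e) 0 (PI / 2)
      ((ln (e + a) - ln c) / e + PI / 2 / e)).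
  { apply (is_RInt_plus (V := R_NormedModule)); [exact I|].
    replace (PI / 2 / e) with (scal (PI / 2 - 0) (/ e))
      by (unfold scal; simpl; unfold mult; simpl; unfold Rdiv; ring).
    apply (is_RInt_const (V := R_NormedModule)). }
  assert (G : RInt (fun t => / sqrt (g t)) 0 (PI / 2) = gauss_int a c).
  { rewrite gauss_int_sym by assumption. apply RInt_ext. intros t _. unfold gauss_form, g.
    rewrite cos2_sin2, Hace. do 2 f_equal. ring. }
  assert (X : ex_RInt (fun t => / sqrt (g t)) 0 (PI / 2)).
  { eapply ex_RInt_ext; [|apply (ex_RInt_gauss c a); assumption]. intros t _.
    unfold gauss_form, g. rewrite cos2_sin2, Hace. do 2 f_equal. ring. }
  rewrite <- G. rewrite <- (is_RInt_unique _ _ _ _ I) at 1.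
  rewrite <- (is_RInt_unique _ _ _ _ Isum).
  split; apply RInt_le; try lra; try exact X; try (eexists; eassumption);
  intros t Ht.
  - pose proof (COS_bound t). pose proof (Rinv_0_lt_compat _ (Hs t)). unfold Rdiv. nra.
  - assert (S := sin_gt_0 t ltac:(lra) ltac:(lra)). assert (C := cos_gt_0 t ltac:(lra) ltac:(lra)).
    assert (SC : 1 - cos t <= sin t).
    { pose proof (cos2_sin2 t). nra. }
    specialize (Hes t). rewrite Rabs_pos_eq in Hes by lra. specialize (Hs t).
    apply (Rmult_le_reg_r (sqrt (g t) * e)); [nra|].
    replace (/ sqrt (g t) * (sqrt (g t) * e)) with e by (field; lra).
    replace ((cos t / sqrt (g t) + / e) * (sqrt (g t) * e)) with (e * cos t + sqrt (g t)) by (field; lra).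
    nra.
Qed.

(** * Theta values of Gauss's integral *)

Lemma gauss_int_theta_step x : 0 < x < 1 ->
  gauss_int (theta (x ^ 2) ^ 2) (theta (- x ^ 2) ^ 2) = gauss_int (theta x ^ 2) (theta (- x) ^ 2).
Proof.
  intros Hx. pose proof (theta_ge_1 x Hx). pose proof (theta_opp_pos x Hx).
  rewrite <- (gauss_int_landen (theta x ^ 2)) by (apply pow_lt; lra). f_equal.
  - pose proof (theta_sqr_add_theta_opp_sqr x (Rabs_unit_interval x Hx)). lra.
  - rewrite <- theta_mul_theta_opp by now apply Rabs_unit_interval.
    rewrite <- Rpow_mult_distr, sqrt_pow2; [reflexivity|nra].
Qed.

(** The pair of squares follows the AGM recursion under [q |-> q^2] and both
    entries tend to 1, so the integral equals its value at (1, 1). *)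
Lemma gauss_int_theta q : 0 < q < 1 -> gauss_int (theta q ^ 2) (theta (- q) ^ 2) = PI / 2.
Proof.
  intros Hq. set (G := fun x => gauss_int (theta x ^ 2) (theta (- x) ^ 2)).
  change (G q = PI / 2).
  assert (Hinv : forall n, G (nome_iter q n) = G q).
  { induction n as [|n IH]; [now rewrite nome_iter_0|].
    rewrite <- IH, nome_iter_S. exact (gauss_int_theta_step _ (nome_iter_bounds q n Hq)). }
  assert (Hb : forall n, PI / 2 / theta (nome_iter q n) ^ 2 <= G q <= PI / 2 / theta (- nome_iter q n) ^ 2).
  { intros n. rewrite <- (Hinv n). apply gauss_int_bounds.
    pose proof (theta_opp_pos _ (nome_iter_bounds q n Hq)).
    pose proof (theta_opp_bounds _ (nome_iter_bounds q n Hq)).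
    split; [apply pow_lt; lra | apply pow_incr; lra]. }
  assert (L1 : is_lim_seq (fun n => theta (nome_iter q n)) 1).
  { eapply is_lim_seq_ext; [|exact (theta_nome_lim q 1 Hq (or_introl eq_refl))].
    intros n; cbv beta. now rewrite Rmult_1_l. }
  assert (L2 := theta_opp_nome_lim q Hq).
  assert (Lim : forall u : nat -> R, is_lim_seq u 1 -> is_lim_seq (fun n => PI / 2 / u n ^ 2) (PI / 2)).
  { intros u Hu. replace (Finite (PI / 2)) with (Finite (PI / 2 / (1 * 1))) by (f_equal; field).
    apply is_lim_seq_ext with (fun n => PI / 2 / (u n * u n)).
    - intros n. f_equal. ring.
    - apply is_lim_seq_div'; [apply is_lim_seq_const | now apply is_lim_seq_mult' | lra]. }
  assert (L := is_lim_seq_le_le _ _ _ _ Hb (Lim _ L1) (Lim _ L2)).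
  apply is_lim_seq_unique in L. rewrite Lim_seq_const in L. now injection L.
Qed.

(** Jacobi's theta_2(q)^2, through the quartic relation between the three thetas. *)
Definition theta2_sqr (x : R) : R := sqrt ((theta x ^ 2) ^ 2 - (theta (- x) ^ 2) ^ 2).

Lemma theta2_sqr_step x : 0 < x < 1 ->
  theta2_sqr (x ^ 2) = (theta x ^ 2 - theta (- x) ^ 2) / 2.
Proof.
  intros Hx. unfold theta2_sqr.
  pose proof (theta_opp_bounds x Hx).
  assert (S := theta_sqr_add_theta_opp_sqr x (Rabs_unit_interval x Hx)).
  rewrite <- theta_mul_theta_opp by now apply Rabs_unit_interval.
  replace (theta (x ^ 2) ^ 2) with ((theta x ^ 2 + theta (- x) ^ 2) / 2) by lra.
  match goal with |- sqrt ?e = _ =>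
    replace e with (((theta x ^ 2 - theta (- x) ^ 2) / 2) ^ 2) by field end.
  apply sqrt_pow2. nra.
Qed.

Lemma theta_opp_lt x : 0 < x < 1 -> 0 < theta (- x) < theta x.
Proof.
  intros Hx. split; [now apply theta_opp_pos|].
  pose proof (theta_sub_theta_opp x Hx). pose proof (pronic_theta_ge_1 x Hx). nra.
Qed.

Lemma theta2_sqr_pos x : 0 < x < 1 -> 0 < theta2_sqr x.
Proof.
  intros Hx. apply sqrt_lt_R0. pose proof (theta_opp_lt x Hx).
  assert (theta (- x) ^ 2 < theta x ^ 2) by nra.
  assert (0 < theta (- x) ^ 2) by nra. nra.
Qed.

(** With [A, B] the squares of [theta] at [x] and [- x], the pair at [x^2] is half
    of [(A + B, A - B)], and one AGM step leads from [(A + B, A - B)] to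
    [(A, sqrt (A^2 - B^2))], the pair at [x]. *)
Lemma gauss_int_theta2_step x : 0 < x < 1 ->
  gauss_int (theta (x ^ 2) ^ 2) (theta2_sqr (x ^ 2)) = 2 * gauss_int (theta x ^ 2) (theta2_sqr x).
Proof.
  intros Hx. pose proof (theta_opp_lt x Hx).
  assert (S := theta_sqr_add_theta_opp_sqr x (Rabs_unit_interval x Hx)).
  assert (theta (- x) ^ 2 < theta x ^ 2) by nra. assert (0 < theta (- x) ^ 2) by nra.
  rewrite theta2_sqr_step by exact Hx. unfold theta2_sqr.
  set (A := theta x ^ 2) in *. set (B := theta (- x) ^ 2) in *. clearbody A B.
  replace (theta (x ^ 2) ^ 2) with (/ 2 * (A + B)) by lra.
  replace ((A - B) / 2) with (/ 2 * (A - B)) by lra.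
  rewrite gauss_int_scal by lra. rewrite <- (gauss_int_landen (A + B) (A - B)) by lra.
  replace ((A + B + (A - B)) / 2) with A by field.
  replace ((A + B) * (A - B)) with (A ^ 2 - B ^ 2) by ring. field.
Qed.

(** By [gauss_int_theta2_step], [2^n X] is the integral at [q^(2^n)], where
    [theta2_sqr] is comparable to [4 q^(2^(n-1))]. The logarithmic bounds thus give
    [2^n X = - 2^(n-1) ln q + O(1)] up to a factor tending to 1; dividing by [2^n]
    leaves [X = - ln q / 2]. *)
Lemma gauss_int_theta2 q : 0 < q < 1 ->
  gauss_int (theta q ^ 2) (theta2_sqr q) = - ln q / 2.
Proof.
  intros Hq. set (X := gauss_int (theta q ^ 2) (theta2_sqr q)).
  assert (Hinv : forall n, gauss_int (theta (nome_iter q n) ^ 2) (theta2_sqr (nome_iter q n)) = 2 ^ n * X).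
  { induction n as [|n IH].
    - rewrite nome_iter_0. unfold X. simpl. ring.
    - rewrite nome_iter_S, gauss_int_theta2_step, IH by now apply nome_iter_bounds. simpl. ring. }
  assert (T := theta_ge_1 q Hq). assert (P := pronic_theta_ge_1 q Hq). assert (PP := PI_RGT_0).
  (* [C] collects uniform bounds for the two logarithms other than [ln q] and for the
     width [PI / 2] of the window in [gauss_int_log_bounds]. *)
  set (C := ln (2 * theta q ^ 2) + ln (pronic_theta q * (2 * theta q)) + PI / 2).
  assert (ln0 : forall u v, 1 <= u <= v -> 0 <= ln u <= ln v).
  { intros u v Huv. split; [rewrite <- ln_1; apply ln_le; lra | apply ln_le; lra]. }
  assert (Hbound : forall n, - C * (1 / 2) ^ S n <=
     theta (- nome_iter q (S n)) ^ 2 * X + ln q / 2 <= C * (1 / 2) ^ S n).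
  { intros n. set (x := nome_iter q n).
    assert (Hx : 0 < x < 1) by now apply nome_iter_bounds.
    assert (Hxq : x <= q) by now apply nome_iter_le.
    assert (Hlnx : ln x = 2 ^ n * ln q).
    { unfold x, nome_iter. rewrite ln_pow by lra. now rewrite pow_INR. }
    assert (Hx2 := sqr_unit_interval x Hx).
    rewrite nome_iter_S. fold x.
    assert (HX := Hinv (S n)). rewrite nome_iter_S in HX. fold x in HX.
    assert (M1 := theta_mono x q ltac:(lra) ltac:(lra)).
    assert (M2 := theta_mono (x ^ 2) q ltac:(nra) ltac:(lra)).
    assert (M3 := pronic_theta_mono x q ltac:(lra) ltac:(lra)).
    assert (O1 := theta_opp_lt x Hx). assert (O2 := theta_opp_lt _ Hx2).
    assert (T1 := theta_ge_1 x Hx). assert (T2 := theta_ge_1 _ Hx2).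
    assert (P1 := pronic_theta_ge_1 x Hx).
    assert (E := theta2_sqr_step x Hx).
    assert (E' : theta2_sqr (x ^ 2) = x * (pronic_theta x * (theta x + theta (- x)))).
    { rewrite E. pose proof (theta_sub_theta_opp x Hx) as D.
      replace (theta x ^ 2 - theta (- x) ^ 2) with ((theta x - theta (- x)) * (theta x + theta (- x))) by ring.
      rewrite D. field. }
    assert (G := gauss_int_log_bounds (theta (x ^ 2) ^ 2) (theta2_sqr (x ^ 2)) (theta (- x ^ 2) ^ 2)
      (theta2_sqr_pos _ Hx2) ltac:(apply pow_lt; lra) ltac:(apply pow_lt; lra)).
    assert (Hpy : (theta (x ^ 2) ^ 2) ^ 2 = theta2_sqr (x ^ 2) ^ 2 + (theta (- x ^ 2) ^ 2) ^ 2).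
    { unfold theta2_sqr at 1. rewrite pow2_sqrt; [ring|].
      assert (theta (- x ^ 2) ^ 2 < theta (x ^ 2) ^ 2) by nra.
      assert (0 < theta (- x ^ 2) ^ 2) by nra. nra. }
    specialize (G Hpy). rewrite HX in G. rewrite E' in G.
    set (h := pronic_theta x * (theta x + theta (- x))) in *.
    assert (Hh : 1 <= h <= pronic_theta q * (2 * theta q)).
    { unfold h. split; [nra|]. apply Rmult_le_compat; lra. }
    rewrite ln_mult, Hlnx in G by lra.
    set (e := theta (- x ^ 2) ^ 2) in *. set (a := theta (x ^ 2) ^ 2) in *.
    assert (He : 0 < e) by (unfold e; apply pow_lt; lra).
    assert (Hea : 1 <= e + a <= 2 * theta q ^ 2).
    { assert (e <= a) by (unfold e, a; apply pow_incr; lra).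
      assert (a <= theta q ^ 2) by (unfold a; apply pow_incr; lra).
      assert (1 <= a) by (unfold a; nra). lra. }
    assert (L1 := ln0 _ _ Hh). assert (L2 := ln0 _ _ Hea).
    set (w := (1 / 2) ^ S n).
    assert (Hw : 0 < w) by (apply pow_lt; lra).
    assert (H2n : 2 ^ n = / (2 * w)).
    { unfold w. simpl. replace (1 / 2) with (/ 2) by field. rewrite pow_inv.
      assert (0 < 2 ^ n) by (apply pow_lt; lra). field. lra. }
    simpl pow in G. rewrite H2n in G.
    assert (G' : ln (e + a) - (/ (2 * w) * ln q + ln h) <= e * (2 * / (2 * w) * X) <=
       ln (e + a) - (/ (2 * w) * ln q + ln h) + PI / 2).
    { destruct G as [G1 G2]. rewrite <- Rdiv_plus_distr in G2.
      apply (proj1 (Rle_div_l _ _ _ He)) in G1. apply (proj2 (Rle_div_r _ _ _ He)) in G2.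
      split; lra. }
    assert (Gw : w * (ln (e + a) - ln h) <= e * X + ln q / 2 <= w * (ln (e + a) - ln h + PI / 2)).
    { destruct G' as [G1 G2].
      apply (Rmult_le_compat_l w) in G1; [|lra]. apply (Rmult_le_compat_l w) in G2; [|lra].
      replace (w * (e * (2 * / (2 * w) * X))) with (e * X) in * by (field; lra).
      replace (w * (ln (e + a) - (/ (2 * w) * ln q + ln h))) with
        (w * (ln (e + a) - ln h) - ln q / 2) in G1 by (field; lra).
      replace (w * (ln (e + a) - (/ (2 * w) * ln q + ln h) + PI / 2)) with
        (w * (ln (e + a) - ln h + PI / 2) - ln q / 2) in G2 by (field; lra).
      lra. }
    unfold C. split; nra. }
  assert (L0 : forall c, is_lim_seq (fun n => c * (1 / 2) ^ S n) 0).
  { intros c. replace (Finite 0) with (Finite (c * 0)) by (f_equal; ring).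
    apply (is_lim_seq_incr_1 (fun n => c * (1 / 2) ^ n)).
    apply is_lim_seq_mult'; [apply is_lim_seq_const|]. apply is_lim_seq_geom.
    rewrite Rabs_pos_eq; lra. }
  assert (L1 := is_lim_seq_le_le _ _ _ _ Hbound (L0 _) (L0 _)).
  assert (L2 : is_lim_seq (fun n => theta (- nome_iter q (S n)) ^ 2 * X + ln q / 2) (1 * 1 * X + ln q / 2)).
  { assert (Lt := theta_opp_nome_lim q Hq). apply is_lim_seq_incr_1 in Lt.
    apply is_lim_seq_plus'; [|apply is_lim_seq_const].
    apply is_lim_seq_mult'; [|apply is_lim_seq_const].
    eapply is_lim_seq_ext; [|exact (is_lim_seq_mult' _ _ _ _ Lt Lt)].
    intros n; cbv beta. ring. }
  apply is_lim_seq_unique in L1. apply is_lim_seq_unique in L2. rewrite L1 in L2.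
  injection L2 as L2. lra.
Qed.

(** * The nome of an elliptic modulus *)

(** Intermediate value theorem: the quotient of the two squares is close to 1 near
    0, and it is at most [1 / theta q ^ 4] by [theta_mul_theta_opp_le_1], which
    becomes arbitrarily small. *)
Lemma nome_exists r : 0 < r < 1 -> exists q, 0 < q < 1 /\ theta (- q) ^ 2 = r * theta q ^ 2.
Proof.
  intros Hr.
  set (f := fun x => r * theta (1 * x) ^ 2 - theta (-1 * x) ^ 2).
  assert (Hcont : forall x, 0 < x < 1 -> continuity_pt f x).
  { intros x Hx. unfold f.
    assert (C1 := theta_continuous 1 x (or_introl eq_refl) Hx).
    assert (C2 := theta_continuous (-1) x (or_intror eq_refl) Hx).
    set (g1 := fun x => theta (1 * x)) in *. set (g2 := fun x => theta (-1 * x)) in *.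
    apply (continuity_pt_minus (fun x => r * g1 x ^ 2) (fun x => g2 x ^ 2)).
    - apply (continuity_pt_mult (fun _ => r) (fun x => g1 x ^ 2)).
      + apply continuity_pt_const. intros ? ?; reflexivity.
      + apply (continuity_pt_comp g1 (fun y => y ^ 2)); [exact C1|].
        apply derivable_continuous_pt, derivable_pt_pow.
    - apply (continuity_pt_comp g2 (fun y => y ^ 2)); [exact C2|].
      apply derivable_continuous_pt, derivable_pt_pow. }
  destruct (nfloor_ex (/ r)) as [m Hm]; [apply Rlt_le, Rinv_0_lt_compat; lra|].
  destruct (theta_unbounded (S m)) as (x1 & Hx1 & HM).
  assert (F1 : 0 < f x1).
  { unfold f. rewrite Rmult_1_l. replace (-1 * x1) with (- x1) by ring.
    rewrite S_INR in HM.
    assert (1 < r * theta x1).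
    { apply Rlt_le_trans with (r * (INR m + 1)); [|apply Rmult_le_compat_l; lra].
      replace 1 with (r * / r) at 1 by (field; lra). apply Rmult_lt_compat_l; lra. }
    pose proof (theta_mul_theta_opp_le_1 x1 Hx1). pose proof (theta_opp_lt x1 Hx1).
    pose proof (theta_ge_1 x1 Hx1).
    assert (theta (- x1) <= 1) by nra. assert (theta (- x1) ^ 2 <= 1) by nra. nra. }
  assert (L : filterlim f (at_right 0) (locally (r * (1 * 1) - 1 * 1))).
  { unfold f.
    assert (Lm : forall g : R -> R, filterlim g (at_right 0) (locally 1) ->
      filterlim (fun x => g x ^ 2) (at_right 0) (locally (1 * 1))).
    { intros g Hg. apply filterlim_ext with (fun x => g x * g x); [intros; ring|].
      eapply filterlim_comp_2; [exact Hg | exact Hg | apply (filterlim_mult (K := R_AbsRing))]. }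
    assert (La := Lm _ (theta_lim_0 1 (or_introl eq_refl))).
    assert (Lb := Lm _ (theta_lim_0 (-1) (or_intror eq_refl))).
    assert (Lr : filterlim (fun x => r * theta (1 * x) ^ 2) (at_right 0) (locally (r * (1 * 1)))).
    { eapply filterlim_comp_2; [apply filterlim_const | exact La | apply (filterlim_mult (K := R_AbsRing))]. }
    assert (Ln : filterlim (fun x => - theta (-1 * x) ^ 2) (at_right 0) (locally (- (1 * 1)))).
    { eapply filterlim_comp; [exact Lb | apply (filterlim_opp (V := R_NormedModule))]. }
    unfold Rminus.
    eapply filterlim_comp_2; [exact Lr | exact Ln | apply (filterlim_plus (V := R_NormedModule))]. }
  assert (Hneg : at_right 0 (fun x => f x < 0)).
  { apply (L (fun y => y < 0)). apply (open_lt 0). lra. }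
  assert (Hlow := at_right_0_lt x1 (proj1 Hx1)).
  destruct (filter_ex _ (filter_and _ _ Hneg Hlow)) as (x0 & F0 & Hx0).
  destruct (IVT_interv f x0 x1) as (q & Hq & Fq).
  - intros x Hx. apply Hcont. lra.
  - lra.
  - exact F0.
  - exact F1.
  - exists q. split; [lra|]. unfold f in Fq. rewrite Rmult_1_l in Fq.
    replace (-1 * q) with (- q) in Fq by ring. lra.
Qed.

Lemma ellipticK_gauss_int k l : k ^ 2 + l ^ 2 = 1 -> ellipticK k = gauss_int 1 l.
Proof.
  intros H. apply RInt_ext. intros t _. unfold gauss_form. unfold Rdiv. rewrite Rmult_1_l.
  do 2 f_equal. replace (l ^ 2) with (1 - k ^ 2) by lra. rewrite cos2_sin2. ring.
Qed.

(** Jacobi's inversion: a [q] with the prescribed quotient of thetas is the nome of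
    [k]. By homogeneity the two integrals [gauss_int_theta] and
    [gauss_int_theta2] are [K] and [K'] divided by [theta q ^ 2]. *)
Lemma elliptic_nome k q : 0 < k ^ 2 < 1 -> 0 < q < 1 ->
  theta (- q) ^ 2 = compl_modulus k * theta q ^ 2 ->
  ellipticK k = PI / 2 * theta q ^ 2 /\ ellipticK' k / ellipticK k * PI = - ln q.
Proof.
  intros Hk Hq E. assert (T := theta_ge_1 q Hq). assert (PP := PI_RGT_0).
  set (l := compl_modulus k) in *.
  assert (Hl : l ^ 2 = 1 - k ^ 2) by (apply pow2_sqrt; lra).
  assert (Hl0 : 0 < l) by (apply sqrt_lt_R0; lra).
  assert (Hk0 : 0 < Rabs k) by (apply Rabs_pos_lt; intros ->; lra).
  assert (HA : 0 < theta q ^ 2) by (apply pow_lt; lra).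
  assert (K1 : ellipticK k = gauss_int 1 l) by (apply ellipticK_gauss_int; lra).
  assert (K2 : ellipticK' k = gauss_int 1 (Rabs k)).
  { apply ellipticK_gauss_int. fold l. rewrite pow2_abs. lra. }
  assert (I1 := gauss_int_theta q Hq). assert (I2 := gauss_int_theta2 q Hq).
  rewrite E, (Rmult_comm l) in I1. rewrite <- (Rmult_1_r (theta q ^ 2)) in I1 at 1.
  rewrite gauss_int_scal, <- K1 in I1 by lra.
  replace (theta2_sqr q) with (theta q ^ 2 * Rabs k) in I2.
  - rewrite <- (Rmult_1_r (theta q ^ 2)) in I2 at 1. rewrite gauss_int_scal, <- K2 in I2 by lra.
    assert (EK : ellipticK k = PI / 2 * theta q ^ 2) by (rewrite <- I1; field; lra).
    split; [exact EK|]. rewrite EK.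
    replace (- ln q) with (2 * (- ln q / 2)) by field. rewrite <- I2. field. lra.
  - unfold theta2_sqr. rewrite E.
    replace ((theta q ^ 2) ^ 2 - (l * theta q ^ 2) ^ 2) with ((theta q ^ 2 * Rabs k) ^ 2).
    + symmetry. apply sqrt_pow2. nra.
    + rewrite !Rpow_mult_distr, pow2_abs, Hl. ring.
Qed.

Theorem theorem3 (k : R) (hk : 0 < k ^ 2 < 1)
  (hconv : ex_series (lambert_term k)) :
  Series (lambert_term k)
  = (sqrt (1 - k) + sqrt (1 + k)) * ellipticK k / (2 * PI) - 1 / 2.
Proof.
  assert (PP := PI_RGT_0).
  set (l := compl_modulus k).
  assert (Hl : l ^ 2 = 1 - k ^ 2) by (apply pow2_sqrt; lra).
  assert (Hl0 : 0 < l) by (apply sqrt_lt_R0; lra).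
  destruct (nome_exists l) as (q & Hq & E); [nra|].
  destruct (elliptic_nome k q hk Hq E) as [EK ER].
  assert (T := theta_ge_1 q Hq). assert (T2 := theta_ge_1 _ (sqr_unit_interval q Hq)).
  rewrite (Series_ext _ (fun n => (-1) ^ (n / 2) * (q ^ (2 * n + 1) / (1 - q ^ (2 * n + 1))))).
  - rewrite (is_series_unique _ _ (is_series_lambert q Hq)), EK.
    assert (EL := lambert_sum_eq_theta q Hq).
    replace (lambert_sum q) with (theta q * theta (q ^ 2) / 2) by lra.
    assert (HS : (sqrt (1 - k) + sqrt (1 + k)) * theta q = 2 * theta (q ^ 2)).
    { assert (0 <= sqrt (1 - k)) by apply sqrt_pos. assert (0 <= sqrt (1 + k)) by apply sqrt_pos.
      apply Rsqr_inj; [nra | lra |]. rewrite !Rsqr_pow2, !Rpow_mult_distr.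
      assert (S := theta_sqr_add_theta_opp_sqr q (Rabs_unit_interval q Hq)). rewrite E in S.
      assert (S2 : (sqrt (1 - k) + sqrt (1 + k)) ^ 2 = 2 * (1 + l)).
      { transitivity (sqrt (1 - k) ^ 2 + sqrt (1 + k) ^ 2 + 2 * (sqrt (1 - k) * sqrt (1 + k))); [ring|].
        rewrite !pow2_sqrt, <- sqrt_mult by nra.
        replace ((1 - k) * (1 + k)) with (1 - k ^ 2) by ring. unfold l, compl_modulus. ring. }
      rewrite S2. lra. }
    transitivity (theta q * (2 * theta (q ^ 2)) / 4 - 1 / 2); [field|].
    rewrite <- HS. field. lra.
  - intros n. unfold lambert_term. unfold Rdiv at 1. f_equal.
    replace ((2 * INR n + 1) * (ellipticK' k / ellipticK k) * PI)
      with (INR (2 * n + 1) * - ln q).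
    + assert (P : 0 < q ^ (2 * n + 1) < 1).
      { split; [apply pow_lt; lra | apply pow_lt_1_compat; [lra|lia]]. }
      rewrite <- Ropp_mult_distr_r, <- ln_pow, exp_Ropp, exp_ln by lra.
      field. lra.
    + rewrite plus_INR, mult_INR, <- ER. simpl. ring.
Qed.
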